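(* Let $(M,\tau)$ be a tracial $W^\ast$-probability space and let $X_1,\dots,X_n\in M$ be self-adjoint with $\Phi^\ast(X_1,\dots,X_n)<\infty$. Then, for any non-constant self-adjoint non-commutative polynomial $P\in\mathbb{C}\langle Z_1,\dots,Z_n\rangle$, the distribution $\mu_{P(X_1,\dots,X_n)}$ of $P(X_1,\dots,X_n)$ does not have atoms.
   Context: A tracial $W^\ast$-probability space $(M,\tau)$ is a von Neumann algebra $M$ with a faithful normal tracial state $\tau$. $L^2(M,\tau)$ is the Hilbert space completion of $M$ for $\langle a,b\rangle=\tau(ab^\ast)$, with norm $\|\cdot\|_2$; for $\xi\in L^2(M,\tau)$ and $a\in M$, $\tau(\xi a)$ means $\langle\xi,a^\ast\rangle$. $L^2(X_1,\dots,X_n,\tau)\subset L^2(M,\tau)$ is the closure of the unital algebra $\mathbb{C}\langle X_1,\dots,X_n\rangle$ generated by $X_1,\dots,X_n$. For a self-adjoint $Y\in M$, the distribution $\mu_Y$ is the unique probability measure on $\mathbb{R}$ with $\tau(Y^k)=\int_{\mathbb{R}}t^k\,d\mu_Y(t)$ for $k=0,1,2,\dots$. $\mathbb{C}\langle Z_1,\dots,Z_n\rangle$ is the unital $\ast$-algebra of non-commutative polynomials in $n$ formal self-adjoint variables ($Z_i^\ast=Z_i$). $\partial_j:\mathbb{C}\langle Z_1,\dots,Z_n\rangle\to\mathbb{C}\langle Z_1,\dots,Z_n\rangle^{\otimes2}$ (algebraic tensor product) is the unique linear map with $\partial_j(P_1P_2)=(\partial_jP_1)(1\otimes P_2)+(P_1\otimes1)(\partial_jP_2)$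 and $\partial_jZ_i=\delta_{i,j}1\otimes1$. For $P\in\mathbb{C}\langle Z_1,\dots,Z_n\rangle$, $P(X_1,\dots,X_n)$ denotes evaluation $Z_i\mapsto X_i$; for $Q\in\mathbb{C}\langle Z_1,\dots,Z_n\rangle^{\otimes2}$, $Q(X_1,\dots,X_n)$ denotes evaluation in both tensor factors. A conjugate system for $(X_1,\dots,X_n)$ is a tuple $(\xi_1,\dots,\xi_n)$ of elements of $L^2(X_1,\dots,X_n,\tau)$ such that $(\tau\otimes\tau)((\partial_jP)(X_1,\dots,X_n))=\tau(\xi_jP(X_1,\dots,X_n))$ for all $P\in\mathbb{C}\langle Z_1,\dots,Z_n\rangle$ and all $j=1,\dots,n$; it is unique if it exists. The (non-microstates) free Fisher information is $\Phi^\ast(X_1,\dots,X_n):=\sum_{j=1}^n\|\xi_j\|_2^2$ if a conjugate system exists, and $\Phi^\ast(X_1,\dots,X_n):=\infty$ otherwise. *)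

(* Defs.v *)
From HB Require Import structures.
From mathcomp Require Import all_boot all_order all_algebra.
From mathcomp Require Import all_classical all_reals all_analysis.
From mathcomp Require Import complex.
(* The notations of monalg clash with those of MathComp-Analysis at parsing
   level; `mkmalgU w c` is the monomial c.w, `g @_ w` is `mcoeff w g`. *)
From mathcomp Require Import -(notations) monalg.

Set Implicit Arguments.
Unset Strict Implicit.
Unset Printing Implicit Defensive.

Import Order.TTheory GRing.Theory Num.Theory.
Import numFieldNormedType.Exports.

Local Open Scope classical_set_scope.
Local Open Scope complex_scope.
Local Open Scope ring_scope.

(* The inner product is linear in its first argument and conjugate-linear in
   the second. *)
Record hilbertType (R : realType) := Hilbert {
  hilbert_mod :> completeNormedModType R[i] ;
  hdot : {dot hilbert_mod for @Num.conj R[i]} ;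
  hdot_norm : forall x, `|x| ^+ 2 = hdot x x
}.

Arguments hdot {R h}.

Definition bounded_op (R : realType) (H : hilbertType R) : set (H -> H) :=
  [set T | linear T /\ continuous T].

Definition commutant (R : realType) (H : hilbertType R) (A : set (H -> H)) :
    set (H -> H) :=
  [set S | bounded_op S /\ forall T, A T -> S \o T = T \o S].

Record starAlgType (R : realType) := StarAlg {
  star_alg :> algType R[i] ;
  star : star_alg -> star_alg ;
  starD : {morph star : a b / a + b} ;
  starZ : forall (c : R[i]) a, star (c *: a) = Num.conj c *: star a ;
  starM : forall a b, star (a * b) = star b * star a ;
  starK : involutive star
}.

Definition selfadjoint (R : realType) (A : starAlgType R) (a : A) :=
  star a = a.

(* A von Neumann algebra, given with the Hilbert space on which it acts: a
   *-algebra identified by a faithful unital *-representation with a subalgebra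
   of the bounded operators that equals its own bicommutant. *)
Record vonNeumannType (R : realType) := VonNeumann {
  vN_alg :> starAlgType R ;
  vN_space : hilbertType R ;
  vN_rep : vN_alg -> vN_space -> vN_space ;
  vN_rep_bounded : forall a, bounded_op (vN_rep a) ;
  vN_rep_linear : forall (c : R[i]) a b x,
    vN_rep (c *: a + b) x = c *: vN_rep a x + vN_rep b x ;
  vN_repM : forall a b, vN_rep (a * b) = vN_rep a \o vN_rep b ;
  vN_rep1 : vN_rep 1 = id ;
  vN_rep_star : forall a x y,
    hdot (vN_rep a x) y = hdot x (vN_rep (star a) y) ;
  vN_rep_inj : injective vN_rep ;
  vN_bicommutant : commutant (commutant (range vN_rep)) = range vN_rep
}.

(* The operator (Loewner) order; `0 <= z` in R[i] says that z is a nonnegative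
   real. *)
Definition op_le (R : realType) (M : vonNeumannType R) (a b : M) :=
  forall x : vN_space M, 0 <= hdot (vN_rep (b - a) x) x.

Definition is_lub_of (T : Type) (dom : set T) (le : T -> T -> Prop)
    (D : set T) (s : T) :=
  (forall a, D a -> le a s) /\
  (forall b, dom b -> (forall a, D a -> le a b) -> le s b).

(* Normality: the functional preserves suprema of bounded upward directed
   families of self-adjoint elements. *)
Definition normal_functional (R : realType) (M : vonNeumannType R)
    (f : M -> R[i]) :=
  forall (D : set M) (s : M),
    D !=set0 -> D `<=` @selfadjoint R M ->
    (forall a b, D a -> D b -> exists c, [/\ D c, op_le a c & op_le b c]) ->
    selfadjoint s ->
    is_lub_of (@selfadjoint R M) (@op_le R M) D s ->
    is_lub_of setT (fun z w : R[i] => z <= w) (f @` D) (f s).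

Record tracialWstar (R : realType) := TracialWstar {
  tW_alg :> vonNeumannType R ;
  tau : tW_alg -> R[i] ;
  tau_linear : forall (c : R[i]) a b, tau (c *: a + b) = c * tau a + tau b ;
  tau1 : tau 1 = 1 ;
  tau_ge0 : forall a, 0 <= tau (star a * a) ;
  tau_trace : forall a b, tau (a * b) = tau (b * a) ;
  tau_faithful : forall a, tau (star a * a) = 0 -> a = 0 ;
  tau_normal : normal_functional tau
}.

(* A Hilbert space completion of M for <a, b> = tau (a b^* ); it is unique up to
   a unique isomorphism. *)
Record L2space (R : realType) (M : tracialWstar R) := L2Space {
  L2_hilbert :> hilbertType R ;
  L2_inj : {linear M -> L2_hilbert} ;
  L2_dot : forall a b : M,
    hdot (L2_inj a) (L2_inj b) = tau (a * star b) ;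
  L2_dense : dense (range L2_inj)
}.

(* tau (xi a) for xi in L^2 and a in M *)
Definition L2_tau (R : realType) (M : tracialWstar R) (L : L2space M)
    (xi : L) (a : M) : R[i] :=
  hdot xi (L2_inj L (star a)).

(* C<Z_1,...,Z_n> is the algebra of the free monoid {fmonom 'I_n} of words,
   and its algebraic tensor square is the algebra of the monoid of pairs of
   words, the pair (u, v) standing for the tensor u (x) v. *)
Section PairMonoid.
Variables K1 K2 : monomType.
Implicit Types x y z : (K1 * K2)%type.

Definition pair_one : K1 * K2 := (@mone K1, @mone K2).
Definition pair_mul x y : K1 * K2 := (mmul x.1 y.1, mmul x.2 y.2).

Lemma pair_mulA : associative pair_mul.
Proof. by move=> x y z; rewrite /pair_mul /= !mulmA. Qed.
Lemma pair_mul1m : left_id pair_one pair_mul.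
Proof. by case=> a b; rewrite /pair_mul /= !mul1m. Qed.
Lemma pair_mulm1 : right_id pair_one pair_mul.
Proof. by case=> a b; rewrite /pair_mul /= !mulm1. Qed.
Lemma pair_unitm x y : pair_mul x y = pair_one -> x = pair_one /\ y = pair_one.
Proof.
by case: x y => [a b] [c d] [] /unitm[-> ->] /unitm[-> ->].
Qed.

HB.instance Definition _ := Choice_isMonomialDef.Build (K1 * K2)%type
  pair_mulA pair_mul1m pair_mulm1 pair_unitm.
End PairMonoid.

Notation ncpoly R n := (malg (fmonom 'I_n) R[i]).
Notation nctens R n := (malg (fmonom 'I_n * fmonom 'I_n)%type R[i]).

Definition ncvar (R : realType) n (i : 'I_n) : ncpoly R n := mkmalgU (fmu i) 1.

Definition ncconst (R : realType) n (c : R[i]) : ncpoly R n := c%:A.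

Definition nctensor (R : realType) n (P Q : ncpoly R n) : nctens R n :=
  mmap (in_alg (nctens R n))
    (fun u => mmap (in_alg (nctens R n)) (fun v => mkmalgU (u, v) 1) Q) P.

Definition ncstar (R : realType) n (P : ncpoly R n) : ncpoly R n :=
  mmap (fun c : R[i] => (Num.conj c)%:A)
    (fun w : fmonom 'I_n => mkmalgU (FMonom (rev w)) 1) P.

(* On words, d_j w is the sum of u (x) v over all factorizations w = u Z_j v. *)
Definition ncdiff_word (R : realType) n (j : 'I_n) (w : fmonom 'I_n) :
    nctens R n :=
  \sum_(k <- iota 0 (size w) | onth w k == Some j)
    mkmalgU (FMonom (take k w), FMonom (drop k.+1 w)) 1.

Definition ncdiff (R : realType) n (j : 'I_n) (P : ncpoly R n) : nctens R n :=
  mmap (in_alg (nctens R n)) (ncdiff_word R j) P.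

Definition nceval (R : realType) n (A : algType R[i]) (X : 'I_n -> A)
    (P : ncpoly R n) : A :=
  mmap (in_alg A) (fun w : fmonom 'I_n => \prod_(i <- w) X i) P.

(* (tau (x) tau) (Q (X_1, ..., X_n)) for Q in the tensor square *)
Definition tau2_eval (R : realType) (M : tracialWstar R) n (X : 'I_n -> M)
    (Q : nctens R n) : R[i] :=
  mmap (@idfun R[i])
    (fun uv : fmonom 'I_n * fmonom 'I_n =>
       tau (\prod_(i <- uv.1) X i) * tau (\prod_(i <- uv.2) X i)) Q.

(* L^2(X_1, ..., X_n, tau) *)
Definition L2_gen (R : realType) (M : tracialWstar R) (L : L2space M) n
    (X : 'I_n -> M) : set L :=
  closure (range (fun P : ncpoly R n => L2_inj L (nceval X P))).

Definition conjugate_system (R : realType) (M : tracialWstar R)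
    (L : L2space M) n (X : 'I_n -> M) (xi : 'I_n -> L) :=
  (forall j, L2_gen X (xi j)) /\
  (forall (P : ncpoly R n) j,
     tau2_eval X (ncdiff j P) = L2_tau (xi j) (nceval X P)).

Definition free_Fisher (R : realType) (M : tracialWstar R) (L : L2space M) n
    (X : 'I_n -> M) : \bar R :=
  if pselect (exists xi, @conjugate_system R M L n X xi) is left h
  then (\sum_(j < n) complex.Re (`|sval (cid h) j| ^+ 2))%:E
  else +oo%E.

(* mu is the distribution of the self-adjoint element Y *)
Definition is_distribution (R : realType) (M : tracialWstar R) (Y : M)
    (mu : probability (measurableTypeR R) R) :=
  forall k : nat,
    mu.-integrable setT (fun t : measurableTypeR R => (t ^+ k)%:E) /\
    tau (Y ^+ k) = (Rintegral mu setT (fun t : measurableTypeR R => t ^+ k))%:C.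

(* ncdiff j is the unique linear map with d_j Z_i = delta_ij 1 (x) 1 and
   d_j (P Q) = (d_j P) (1 (x) Q) + (P (x) 1) (d_j Q); nctensor, tau2_eval and
   ncstar behave as expected; conjugate systems are unique. *)
Section Sanity.
Variable R : realType.
Implicit Type n : nat.

Lemma malg_mono_ind (K : choiceType) (Pr : malg K R[i] -> Prop) :
  Pr 0 -> (forall g h, Pr g -> Pr h -> Pr (g + h)) ->
  (forall k c, Pr (mkmalgU k c)) -> forall g, Pr g.
Proof. by move=> P0 PD PU g; rewrite (monalgE g); apply: big_ind. Qed.

Lemma mmapAZ (K : choiceType) (A : lalgType R[i]) (h : K -> A) (c : R[i])
    (g : malg K R[i]) :
  mmap (in_alg A) h (c *: g) = c *: mmap (in_alg A) h g.
Proof.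
rewrite (mmapEw (msuppZ_le _ _)) mmapE scaler_sumr.
by apply: eq_bigr => k _; rewrite mcoeffZ /= !mulr_algl scalerA.
Qed.

Lemma mkmalgUZ (K : choiceType) (k : K) (c : R[i]) :
  mkmalgU k c = c *: mkmalgU k 1.
Proof. by apply/malgP => k'; rewrite mcoeffZ !mcoeffU mulrnAr mulr1. Qed.

Lemma mkmalgUM (K : monomType) (k l : K) (c d : R[i]) :
  mkmalgU k c * mkmalgU l d = mkmalgU (mmul k l) (c * d).
Proof.
rewrite (@malgMEw _ _ (finmap.fset1 k) (finmap.fset1 l)) ?msuppU_le //.
by rewrite !finmap.big_seq_fset1 !mcoeffUU.
Qed.

Lemma malg_scalerAr (K : monomType) (c : R[i]) (x y : malg K R[i]) :
  x * (c *: y) = c *: (x * y).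
Proof.
elim/malg_mono_ind: x => [|g h eg eh|k a]; first by rewrite !mul0r scaler0.
  by rewrite !mulrDl eg eh scalerDr.
elim/malg_mono_ind: y => [|g h eg eh|l b].
- by rewrite scaler0 !mulr0 scaler0.
- rewrite [X in _ * X = _]scalerDr [LHS]mulrDr [X in _ = _ *: X]mulrDr.
  by rewrite [RHS]scalerDr; congr (_ + _); [exact eg|exact eh].
rewrite (mkmalgUZ l b) scalerA -!(mkmalgUZ l) !mkmalgUM.
by rewrite mkmalgUZ [in RHS]mkmalgUZ scalerA mulrCA.
Qed.

Lemma malg_scalerM (K : monomType) (c d : R[i]) (x y : malg K R[i]) :
  (c *: x) * (d *: y) = (c * d) *: (x * y).
Proof. by rewrite malg_scalerAr -scalerAl scalerA mulrC. Qed.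

Lemma ncdiff_linear n (j : 'I_n) : linear (ncdiff (R := R) j).
Proof.
by move=> c P Q; rewrite /ncdiff raddfD /=; congr (_ + _); exact: mmapAZ.
Qed.

Lemma ncdiffZ n (j : 'I_n) (c : R[i]) (P : ncpoly R n) :
  ncdiff j (c *: P) = c *: ncdiff j P.
Proof. exact: mmapAZ. Qed.

Lemma ncdiffD n (j : 'I_n) (P Q : ncpoly R n) :
  ncdiff j (P + Q) = ncdiff j P + ncdiff j Q.
Proof. by rewrite /ncdiff raddfD. Qed.

Lemma ncdiffU n (j : 'I_n) w (c : R[i]) :
  ncdiff j (mkmalgU w c) = c *: ncdiff_word R j w.
Proof. by rewrite /ncdiff mmapU /= mulr_algl. Qed.

Lemma nctensorDl n (P P' Q : ncpoly R n) :
  nctensor (P + P') Q = nctensor P Q + nctensor P' Q.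
Proof. by rewrite /nctensor raddfD. Qed.

Lemma nctensorDr n (P Q Q' : ncpoly R n) :
  nctensor P (Q + Q') = nctensor P Q + nctensor P Q'.
Proof.
rewrite /nctensor /mmap -big_split /=; apply: eq_bigr => u _.
rewrite -mulrDr; congr (_ * _).
exact: (@mmapD _ _ _ (in_alg (nctens R n)) (fun v => mkmalgU (u, v) 1) Q Q').
Qed.

Lemma nctensorUU n u v (c d : R[i]) :
  nctensor (mkmalgU u c : ncpoly R n) (mkmalgU v d) = mkmalgU (u, v) (c * d).
Proof.
by rewrite /nctensor !mmapU /= !mulr_algl scalerA [RHS]mkmalgUZ.
Qed.

Lemma nctensor0l n (Q : ncpoly R n) : nctensor 0 Q = 0.
Proof. by rewrite /nctensor raddf0. Qed.

Lemma nctensor0r n (P : ncpoly R n) : nctensor P 0 = 0.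
Proof.
by rewrite /nctensor {1}/mmap big1 // => u _; rewrite raddf0 mulr0.
Qed.

Lemma nctensorM n (P P' Q Q' : ncpoly R n) :
  nctensor P Q * nctensor P' Q' = nctensor (P * P') (Q * Q').
Proof.
elim/malg_mono_ind: P => [|g h eg eh|u a].
- by rewrite mul0r !nctensor0l mul0r.
- rewrite (nctensorDl g h) (mulrDl (nctensor g Q)) 
    [X in _ = nctensor X _](mulrDl g) [in RHS](nctensorDl (g * _)).
  by congr (_ + _); [exact eg|exact eh].
elim/malg_mono_ind: P' => [|g h eg eh|u' a'].
- by rewrite mulr0 !nctensor0l mulr0.
- rewrite (nctensorDl g h) (mulrDr _ (nctensor g Q')) 
    [X in _ = nctensor X _](mulrDr _ g) [in RHS](nctensorDl (_ * g)).
  by congr (_ + _); [exact eg|exact eh].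
elim/malg_mono_ind: Q => [|g h eg eh|v b].
- by rewrite mul0r !nctensor0r mul0r.
- rewrite (nctensorDr _ g h) (mulrDl (nctensor _ g)) 
    [X in _ = nctensor _ X](mulrDl g) [in RHS](nctensorDr _ (g * _)).
  by congr (_ + _); [exact eg|exact eh].
elim/malg_mono_ind: Q' => [|g h eg eh|v' b'].
- by rewrite mulr0 !nctensor0r mulr0.
- rewrite (nctensorDr _ g h) (mulrDr _ (nctensor _ g)) 
    [X in _ = nctensor _ X](mulrDr _ g) [in RHS](nctensorDr _ (_ * g)).
  by congr (_ + _); [exact eg|exact eh].
by rewrite !nctensorUU !mkmalgUM !nctensorUU mulrACA.
Qed.

Lemma ncdiff_var n (i j : 'I_n) :
  ncdiff j (ncvar R i) = (i == j)%:R *: nctensor 1 1.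
Proof.
rewrite ncdiffU scale1r /ncdiff_word fmU big_cons big_nil /= addr0.
rewrite nctensorUU mulr1.
have -> : mone = FMonom [::] :> fmonom 'I_n by rewrite -[LHS]fmK fm1.
by case: eqP => [[->]|ne]; [rewrite eqxx scale1r|case: eqP ne => [->//|]; rewrite scale0r].
Qed.

Lemma ncdiff_word_mul n (j : 'I_n) (u v : fmonom 'I_n) :
  ncdiff_word R j (mmul u v) =
  ncdiff_word R j u * mkmalgU (mone, v) 1 +
  mkmalgU (u, mone) 1 * ncdiff_word R j v.
Proof.
have fmMval (a b : fmonom 'I_n) : mmul a b = FMonom (a ++ b).
  by rewrite -(fmM a b) fmK.
have szE : size (mmul u v) = (size u + size v)%N by rewrite fmM size_cat.
have Z (k l : fmonom 'I_n * fmonom 'I_n) :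
    mkmalgU k 1 * mkmalgU l 1 = mkmalgU (mmul k l) 1 :> nctens R n.
  by rewrite mkmalgUM mulr1.
rewrite /ncdiff_word szE iotaD big_cat /=; congr (_ + _).
  rewrite mulr_suml big_seq_cond [RHS]big_seq_cond; apply: eq_big => [k|k].
    rewrite mem_iota add0n leq0n /= fmM; case: ltnP => //= ku.
    by rewrite !onthE map_cat nth_cat size_map ku.
  rewrite mem_iota add0n leq0n /= => /andP[ku _].
  rewrite Z fmM take_cat drop_cat ku; congr (mkmalgU (_, _) 1).
    by rewrite /= mulm1.
  rewrite /= fmMval /=; case: ltnP => // uk.
  have -> : k.+1 = size u by apply/eqP; rewrite eqn_leq ku.
  by rewrite subnn drop0 drop_size.
rewrite add0n -[X in iota X]addn0 iotaDl big_map mulr_sumr; apply: eq_big => [k|k _].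
  by rewrite fmM !onthE map_cat nth_cat size_map ltnNge leq_addr addKn.
rewrite Z fmM take_cat ltnNge leq_addr /= addKn drop_cat -addnS.
rewrite ltnNge leq_addr /= addKn.
by congr (mkmalgU (_, _) 1); rewrite /= ?mul1m ?fmMval.
Qed.

Lemma ncdiffM n (j : 'I_n) (P Q : ncpoly R n) :
  ncdiff j (P * Q) = ncdiff j P * nctensor 1 Q + nctensor P 1 * ncdiff j Q.
Proof.
have d0 : ncdiff j (0 : ncpoly R n) = 0 by rewrite /ncdiff raddf0.
elim/malg_mono_ind: P => [|g h eg eh|u a].
- rewrite [X in ncdiff j X = _]mul0r [LHS]d0 [X in _ = X * _ + _]d0.
  rewrite [X in _ = _ + X * _]nctensor0l.
  by rewrite [X in _ = X + _]mul0r [X in _ = _ + X]mul0r addr0.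
- rewrite [X in ncdiff j X = _]mulrDl [LHS]ncdiffD.
  rewrite [X in _ = X * _ + _]ncdiffD [X in _ = _ + X * _]nctensorDl.
  rewrite [X in _ = X + _]mulrDl [X in _ = _ + X]mulrDl [RHS]addrACA.
  by congr (_ + _); [exact eg|exact eh].
elim/malg_mono_ind: Q => [|g h eg eh|v b].
- rewrite [X in ncdiff j X = _]mulr0 [LHS]d0 [X in _ = _ + _ * X]d0.
  rewrite [X in _ = _ * X + _]nctensor0r.
  by rewrite [X in _ = X + _]mulr0 [X in _ = _ + X]mulr0 addr0.
- rewrite [X in ncdiff j X = _]mulrDr [LHS]ncdiffD.
  rewrite [X in _ = _ + _ * X]ncdiffD [X in _ = _ * X + _]nctensorDr.
  rewrite [X in _ = X + _]mulrDr [X in _ = _ + X]mulrDr [RHS]addrACA.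
  by congr (_ + _); [exact eg|exact eh].
rewrite [X in ncdiff j X = _]mkmalgUM [LHS]ncdiffU ncdiff_word_mul.
rewrite [X in _ = X * _ + _]ncdiffU [X in _ = _ + _ * X]ncdiffU.
rewrite [X in _ = _ * X + _]nctensorUU [X in _ = _ + X * _]nctensorUU.
rewrite [X in _ = _ * X + _]mkmalgUZ [X in _ = _ + X * _]mkmalgUZ.
rewrite [X in _ = X + _]malg_scalerM [X in _ = _ + X]malg_scalerM.
rewrite [X in _ = (_ * X) *: _ + _]mul1r [X in _ = _ + (X * _) *: _]mulr1.
exact: scalerDr.
Qed.

Lemma ncdiff_unique n (j : 'I_n) (D : ncpoly R n -> nctens R n) :
  linear D ->
  (forall P Q, D (P * Q) = D P * nctensor 1 Q + nctensor P 1 * D Q) ->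
  (forall i, D (ncvar R i) = (i == j)%:R *: nctensor 1 1) ->
  D =1 ncdiff j.
Proof.
move=> linD DM DX.
have D0 : D 0 = 0 by have := linD (-1) 0 0; rewrite scaler0 addr0 scaleN1r addNr.
have DZ c P : D (c *: P) = c *: D P by have := linD c P 0; rewrite !addr0 D0 addr0.
have DD P Q : D (P + Q) = D P + D Q by have := linD 1 P Q; rewrite !scale1r.
have T1 : nctensor 1 1 = 1 :> nctens R n by rewrite nctensorUU mulr1.
have D1 : D 1 = 0.
  have := DM 1 1; rewrite mulr1 T1 mul1r mulr1 => /eqP.
  by rewrite -subr_eq0 opprD addNKr oppr_eq0 => /eqP.
have d1 : ncdiff j (1 : ncpoly R n) = 0.
  have := ncdiffM j 1 1; rewrite mulr1 T1 mul1r mulr1 => /eqP.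
  by rewrite -subr_eq0 opprD addNKr oppr_eq0 => /eqP.
elim/malg_mono_ind => [|g h eg eh|w c].
- by rewrite D0 /ncdiff raddf0.
- by rewrite DD eg eh ncdiffD.
rewrite mkmalgUZ DZ.
rewrite ncdiffZ; congr (_ *: _).
case: w => w; elim: w => [|i w IH].
  have -> : mkmalgU (FMonom [::]) 1 = 1 :> ncpoly R n by rewrite -fmoneE.
  by rewrite D1 d1.
have -> : mkmalgU (FMonom (i :: w)) 1 =
    ncvar R i * mkmalgU (FMonom w) 1 :> ncpoly R n.
  rewrite mkmalgUM mulr1; congr (mkmalgU _ _).
  by rewrite -[RHS]fmK fmM fmU.
by rewrite DM ncdiffM DX ncdiff_var IH.
Qed.

Lemma tau2_evalT (M : tracialWstar R) n (X : 'I_n -> M) (P Q : ncpoly R n) :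
  tau2_eval X (nctensor P Q) = tau (nceval X P) * tau (nceval X Q).
Proof.
have t0 : tau (0 : M) = 0.
  by have := tau_linear (-1) (0 : M) 0; rewrite scaler0 addr0 mulN1r addNr.
have tD (a b : M) : tau (a + b) = tau a + tau b.
  by have := tau_linear 1 a b; rewrite scale1r mul1r.
have tZ c (a : M) : tau (c *: a) = c * tau a.
  by have := tau_linear c a 0; rewrite !addr0 t0 addr0.
have e0 : nceval X (0 : ncpoly R n) = 0 by rewrite /nceval raddf0.
have eD (g h : ncpoly R n) : nceval X (g + h) = nceval X g + nceval X h.
  by rewrite /nceval raddfD.
have eU w (c : R[i]) : nceval X (mkmalgU w c) = c *: \prod_(i <- w) X i.
  by rewrite /nceval mmapU /= mulr_algl.
elim/malg_mono_ind: P => [|g h eg eh|u a].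
- by rewrite nctensor0l e0 t0 mul0r /tau2_eval raddf0.
- by rewrite nctensorDl eD tD mulrDl -eg -eh /tau2_eval raddfD.
elim/malg_mono_ind: Q => [|g h eg eh|v b].
- by rewrite nctensor0r e0 t0 mulr0 /tau2_eval raddf0.
- by rewrite nctensorDr eD tD mulrDr -eg -eh /tau2_eval raddfD.
by rewrite nctensorUU !eU !tZ /tau2_eval mmapU /= mulrACA.
Qed.

Lemma star1 (A : starAlgType R) : star 1 = 1 :> A.
Proof. by rewrite -[LHS]mulr1 -[X in _ * X]starK -starM mulr1 starK. Qed.

Lemma star0 (A : starAlgType R) : star 0 = 0 :> A.
Proof. by rewrite -[X in star X](scale0r (0 : A)) starZ rmorph0 scale0r. Qed.

Lemma nceval_star (A : starAlgType R) n (X : 'I_n -> A) (P : ncpoly R n) :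
  (forall i, selfadjoint (X i)) ->
  nceval X (ncstar P) = star (nceval X P).
Proof.
move=> sX; pose f (c : R[i]) : ncpoly R n := (Num.conj c)%:A.
have fB : zmod_morphism f by move=> c d; rewrite /f rmorphB scalerBl.
pose F := GRing.isZmodMorphism.Build _ _ f fB.
pose fA : {additive R[i] -> ncpoly R n} := HB.pack f F.
pose h := fun w : fmonom 'I_n => mkmalgU (FMonom (rev w)) 1 : ncpoly R n.
have sD g k : ncstar (g + k) = ncstar g + ncstar k := @mmapD _ _ _ fA h g k.
have s0 : ncstar 0 = 0 := @mmap0 _ _ _ fA h.
have sU w c : ncstar (mkmalgU w c) = (Num.conj c)%:A * h w :=
  @mmapU _ _ _ fA h c w.
have e0 : nceval X (0 : ncpoly R n) = 0 by rewrite /nceval raddf0.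
have eD (g k : ncpoly R n) : nceval X (g + k) = nceval X g + nceval X k.
  by rewrite /nceval raddfD.
have eU w (c : R[i]) : nceval X (mkmalgU w c) = c *: \prod_(i <- w) X i.
  by rewrite /nceval mmapU /= mulr_algl.
move: (@ncstar R n) sD s0 sU => s sD s0 sU.
move: (@nceval R n A X) e0 eD eU => e e0 eD eU.
elim/malg_mono_ind: P => [|g k eg ek|w c]; first by rewrite s0 e0 star0.
  by rewrite sD !eD starD eg ek.
rewrite sU mulr_algl -mkmalgUZ !eU starZ; congr (_ *: _).
case: w => w /=; elim: w => [|i w IH]; first by rewrite !big_nil star1.
by rewrite rev_cons -cats1 big_cat big_seq1 big_cons starM sX /= IH.
Qed.

Lemma conjugate_system_unique (M : tracialWstar R) (L : L2space M) n
    (X : 'I_n -> M) (xi xi' : 'I_n -> L) :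
  (forall i, selfadjoint (X i)) ->
  conjugate_system X xi -> conjugate_system X xi' -> xi =1 xi'.
Proof.
move=> sX [cxi exi] [cxi' exi'] j; pose d := xi j - xi' j.
apply/eqP; rewrite -subr_eq0 -/d; apply/negPn/negP => d0.
have orth (P : ncpoly R n) : hdot d (L2_inj L (nceval X P)) = 0.
  have E := esym (exi (ncstar P) j); rewrite exi' in E.
  rewrite /L2_tau nceval_star // starK in E.
  by rewrite /d linearBl /= E subrr.
have nd : 0 < `|d| by rewrite normr_gt0.
have h2 : 0 < `|d| / 2 by rewrite divr_gt0.
have [_ [[P _ <-]]] := cxi j _ (nbhsx_ballx _ _ h2).
have [_ [[Q _ <-]]] := cxi' j _ (nbhsx_ballx _ _ h2).
rewrite -!ball_normE /= => bQ bP.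
set p := L2_inj L _ in bP; set q := L2_inj L _ in bQ.
have lt : `|d - (p - q)| < `|d|.
  have -> : d - (p - q) = (xi j - p) - (xi' j - q).
    by rewrite /d !opprB addrACA [RHS]addrACA [- xi' j - p]addrC.
  apply: le_lt_trans (ler_normB _ _) _.
  by rewrite [X in _ < X]splitr ltrD.
have dp : hdot d (p - q) = 0 by rewrite linearB /= !orth subrr.
have : `|d| ^+ 2 <= `|d - (p - q)| ^+ 2.
  by rewrite !hdot_norm (hnormBd dp) lerDl dnorm_ge0.
by rewrite ler_pXn2r ?nnegrE // => /(lt_le_trans lt); rewrite ltxx.
Qed.
End Sanity.

(* Main.v *)
(* Let u be the spectral projection of P(X) at t, so that Q(X) u = 0 for
   Q = P - t. Everything is done with polynomials: u is the L^2 limit of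
   u_k = (1 - c^2 Q^2)^k, whose squared norms dominate the mass of the atom.

   The heart is that Q(X) u_k -> 0 with bounded u_k forces u_k -> 0 in L^2, for
   every nonzero polynomial Q, by induction on the degree. With v the projection
   onto the kernel of Q(X)^*, the identity
     v . d_j Q . u = d_j (v Q u) - d_j v . Q u - v Q . d_j u
   gives (tau (x) tau) (v . d_j Q . u a) = 0: its left-hand side is controlled by
   the L^2 norms of Q u and v Q, because ||(id (x) tau) d_j P||_2 is at most a
   constant times ||xi_j||_2 + 1 times the operator norm of P (Dabrowski's
   inequality). Hence (tau(v .) (x) id) (d_j Q), a polynomial of smaller degree,
   annihilates u again; its leading coefficient is tau(v) times that of Q, and
   tau(v) is the trace of the projection onto the kernel of Q(X), which dominates
   u. *)

Require Import Defs.
From HB Require Import structures.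
From mathcomp Require Import all_boot all_order all_algebra.
From mathcomp Require Import all_classical all_reals all_analysis.
From mathcomp Require Import complex.
From mathcomp Require Import -(notations) finmap monalg.
From mathcomp Require Import ring lra.

Set Implicit Arguments.
Unset Strict Implicit.
Unset Printing Implicit Defensive.

Import Order.TTheory GRing.Theory Num.Theory.
Import numFieldNormedType.Exports.

Local Open Scope classical_set_scope.
Local Open Scope complex_scope.
Local Open Scope ring_scope.

(** * Real-valued modulus on the complex numbers *)

Section ComplexModulus.
Variable R : realType.
Implicit Types z w : R[i].

(** The norm of [R[i]] takes its values in [R[i]]; its real part moves estimates and limits to the
    ordered field [R]. *)
Definition absc z : R := complex.Re `|z|.

Lemma normc_absc z : `|z| = (absc z)%:C.
Proof. by rewrite /absc RRe_real // normr_real. Qed.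

Lemma absc_ge0 z : 0 <= absc z.
Proof. by rewrite -ler0c -normc_absc. Qed.

Lemma abscD z w : absc (z + w) <= absc z + absc w.
Proof. by rewrite -lecR rmorphD /= -!normc_absc ler_normD. Qed.

Lemma abscN z : absc (- z) = absc z.
Proof. by rewrite /absc normrN. Qed.

Lemma abscB z w : absc (z - w) <= absc z + absc w.
Proof. by rewrite -(abscN w) abscD. Qed.

Lemma absc_eq0 z : (absc z == 0) = (z == 0).
Proof. by rewrite -[RHS]normr_eq0 normc_absc fmorph_eq0. Qed.

Lemma absc_real (x : R) : absc x%:C = `|x|.
Proof.
wlog x0 : x / 0 <= x => [pos|].
  have [x0|/ltW x0] := lerP 0 x; first exact: (pos x x0).
  by rewrite -[x]opprK rmorphN abscN pos ?oppr_ge0 // !normrN.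
by rewrite /absc ger0_norm ?ler0c //= ger0_norm.
Qed.

Lemma Re_le_absc z : complex.Re z <= absc z.
Proof.
apply: le_trans (ler_norm _) _.
by rewrite -lecR -normc_absc normc_ge_Re.
Qed.

Lemma absc_conj z : absc (Num.conj z) = absc z.
Proof. by rewrite /absc norm_conjC. Qed.

End ComplexModulus.

(** * Real-valued Hilbert norm and the Cauchy-Schwarz inequality *)

Section HilbertNorm.
Variables (R : realType) (H : hilbertType R).
Implicit Types x y : H.

Definition hnm x : R := complex.Re `|x|.

Lemma norm_hnm x : `|x| = (hnm x)%:C.
Proof. by rewrite /hnm RRe_real // normr_real. Qed.

Lemma hnm_ge0 x : 0 <= hnm x.
Proof. by rewrite -ler0c -norm_hnm. Qed.

Lemma hdot_hnm x : hdot x x = (hnm x ^+ 2)%:C.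
Proof. by rewrite -hdot_norm norm_hnm rmorphXn. Qed.

Lemma hnmD x y : hnm (x + y) <= hnm x + hnm y.
Proof. by rewrite -lecR rmorphD /= -!norm_hnm ler_normD. Qed.

Lemma hdotC x y : hdot y x = Num.conj (hdot x y).
Proof. by rewrite (hermC hdot y x) expr0 mul1r. Qed.

Lemma cauchy_schwarz x y : absc (hdot x y) <= hnm x * hnm y.
Proof.
have [->|y0] := eqVneq y 0.
  by rewrite linear0r /absc normr0 mulr_ge0 // hnm_ge0.
have ny : 0 < hnm y by rewrite -ltcR -norm_hnm normr_gt0.
have : 0 <= hdot (hdot y y *: x - hdot x y *: y) (hdot y y *: x - hdot x y *: y).
  exact: dnorm_ge0.
rewrite linearBl !linearBr /= !linearZl_LR !linearZr_LR /=.
rewrite (hdotC x y) !(hdot_hnm y) (hdot_hnm x) /=.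
set d := hdot x y.
have dd : d * Num.conj d = (absc d ^+ 2)%:C.
  by rewrite -normCK normc_absc rmorphXn.
rewrite [Num.conj _%:C]conjc_real.
rewrite [X in 0 <= X](_ : _ =
   ((hnm y ^+ 2) * (hnm y ^+ 2 * hnm x ^+ 2 - absc d ^+ 2))%:C); last first.
  have E (a b c : R) : (a * (a * b - c))%:C = a%:C * (a%:C * b%:C - c%:C).
    by rewrite rmorphM rmorphB rmorphM.
  by rewrite E -dd /GRing.scale /=; ring.
rewrite ler0c pmulr_rge0 ?exprn_gt0 // subr_ge0 -exprMn.
rewrite ler_pXn2r ?nnegrE ?absc_ge0 ?mulr_ge0 ?hnm_ge0 //.
by rewrite mulrC.
Qed.

Lemma hnmB_sqr x y :
  hnm (x - y) ^+ 2 = hnm x ^+ 2 + hnm y ^+ 2 - 2 * complex.Re (hdot x y).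
Proof.
have hE z : hnm z ^+ 2 = complex.Re (hdot z z) by rewrite hdot_hnm.
rewrite !hE linearBl !linearBr /= (hdotC x y) !raddfB /=.
have -> : complex.Re (Num.conj (hdot x y)) = complex.Re (hdot x y).
  by case: (hdot x y).
by ring.
Qed.

Lemma cvg_hnm (x_ : nat -> H) (l : H) : x_ k @[k --> \oo] --> l ->
  hnm (l - x_ k) @[k --> \oo] --> (0 : R).
Proof.
move=> xl; apply/cvgrPdist_le => e e0.
have e0' : 0 < e%:C by rewrite ltcR.
move/cvgrPdist_le: xl => /(_ _ e0'); apply: filterS => k.
by rewrite norm_hnm lecR sub0r normrN ger0_norm ?hnm_ge0.
Qed.

End HilbertNorm.

(** * The trace, the 2-norm and bounds for multiplication operators *)

Section Tracial.
Variables (R : realType) (M : tracialWstar R) (L : L2space M).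
Implicit Types a b x y : M.

Lemma tauD a b : tau (a + b) = tau a + tau b.
Proof. by have := tau_linear 1 a b; rewrite scale1r mul1r. Qed.

Lemma tau0 : tau (0 : M) = 0.
Proof. by apply: (addrI (tau (0 : M))); rewrite -tauD !addr0. Qed.

Lemma tauZ (c : R[i]) a : tau (c *: a) = c * tau a.
Proof. by have := tau_linear c a 0; rewrite !addr0 tau0 addr0. Qed.

Lemma tauN a : tau (- a) = - tau a.
Proof. by rewrite -scaleN1r tauZ mulN1r. Qed.

Lemma tauB a b : tau (a - b) = tau a - tau b.
Proof. by rewrite tauD tauN. Qed.

Lemma starN a : star (- a) = - star a.
Proof. by rewrite -scaleN1r starZ rmorphN rmorph1 scaleN1r. Qed.

Lemma starB a b : star (a - b) = star a - star b.
Proof. by rewrite starD starN. Qed.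

Lemma starX a k : star (a ^+ k) = star a ^+ k.
Proof. by elim: k => [|k IH]; [exact: star1|rewrite exprS starM IH -exprSr]. Qed.

Lemma tau_star a : tau (star a) = Num.conj (tau a).
Proof.
have := hdotC (L2_inj L a) (L2_inj L 1).
by rewrite !L2_dot star1 mulr1 mul1r.
Qed.

Definition n2 a : R := hnm (L2_inj L a).

Lemma n2_ge0 a : 0 <= n2 a.
Proof. exact: hnm_ge0. Qed.

Lemma tau_mul_star a : tau (a * star a) = (n2 a ^+ 2)%:C.
Proof. by rewrite -(L2_dot L) hdot_hnm. Qed.

Lemma n2_star a : n2 (star a) = n2 a.
Proof.
apply/eqP; rewrite -(@eqrXn2 _ 2) ?n2_ge0 //; apply/eqP/complexI.
by rewrite -!tau_mul_star starK tau_trace.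
Qed.

Lemma tau_star_mul a : tau (star a * a) = (n2 a ^+ 2)%:C.
Proof. by rewrite tau_trace tau_mul_star. Qed.

Lemma absc_tauM a b : absc (tau (a * b)) <= n2 a * n2 b.
Proof.
rewrite -(n2_star b) -[X in a * X]starK -(L2_dot L).
exact: cauchy_schwarz.
Qed.

Lemma n2D a b : n2 (a + b) <= n2 a + n2 b.
Proof. by rewrite /n2 linearD hnmD. Qed.

Lemma n2Z (c : R[i]) a : n2 (c *: a) = absc c * n2 a.
Proof.
by apply: complexI; rewrite rmorphM /= -normc_absc -!norm_hnm linearZ /= normrZ.
Qed.

Lemma n2N a : n2 (- a) = n2 a.
Proof. by rewrite /n2 linearN /hnm normrN. Qed.

Lemma n2B a b : n2 (a - b) <= n2 a + n2 b.
Proof. by rewrite -(n2N b) n2D. Qed.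

Lemma n20 : n2 0 = 0.
Proof. by rewrite /n2 linear0 /hnm normr0. Qed.

Lemma n21 : n2 1 = 1.
Proof.
apply/eqP; rewrite -(@eqrXn2 _ 2) ?n2_ge0 // expr1n; apply/eqP/complexI.
by rewrite -tau_mul_star star1 mulr1 tau1.
Qed.

Lemma n2B_sqr a b :
  n2 (a - b) ^+ 2 = n2 a ^+ 2 + n2 b ^+ 2 - 2 * complex.Re (tau (a * star b)).
Proof. by rewrite /n2 linearB hnmB_sqr L2_dot. Qed.

Lemma vN_rep0 z : vN_rep (0 : M) z = 0.
Proof.
have := vN_rep_linear (-1) (0 : M) 0 z.
by rewrite scaleN1r oppr0 addr0 scaleN1r addNr.
Qed.

(* By normality, since b is the supremum of the directed family {a, b}. *)
Lemma tau_op_le a b :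
  selfadjoint a -> selfadjoint b -> op_le a b -> tau a <= tau b.
Proof.
move=> sa sb ab.
have refl c : @op_le R M c c by move=> z; rewrite subrr vN_rep0 linear0l.
have [|||||+ _] := @tau_normal R M [set a; b] b.
- by exists a; left.
- by move=> _ [->|->].
- by move=> c d [->|->] [->|->]; exists b; split => //; right.
- exact: sb.
- by split=> [c [->|->] //|c _]; apply; right.
- by apply; exists a => //; left.
Qed.

(* K bounds the norm of left multiplication by a on L^2. *)
Definition opb a (K : R) := 0 <= K /\ forall x, n2 (a * x) <= K * n2 x.

(** A bound r for a on the space where M acts gives x^* a^* a x <= r^2 x^* x in the operator order,
    and tau is monotone for that order. *)
Lemma opb_exists a : exists2 K, 0 < K & opb a K.
Proof.
have [lin cont] := vN_rep_bounded a.
pose F := GRing.isLinear.Build _ _ _ _ (vN_rep a) lin.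
pose f : {linear vN_space M -> vN_space M} := HB.pack (vN_rep a : _ -> _) F.
have [r r0 fr] : exists2 r : R[i], 0 < r & forall z, `|f z| <= r * `|z|.
  have /linear_boundedP/pinfty_ex_gt0 [r r0 fr] :=
    continuous_linear_bounded (f := f) 0 (cont 0).
  by exists r.
have rE : r = (complex.Re r)%:C by rewrite RRe_real // realE ltW.
have K0 : 0 < complex.Re r by rewrite -ltcR -rE.
exists (complex.Re r) => //; split=> [|x]; first exact: ltW.
set K := complex.Re r in rE K0 *.
rewrite -(@ler_pXn2r _ 2) // ?nnegrE ?mulr_ge0 ?n2_ge0 ?(ltW K0) // exprMn.
rewrite -lecR (rmorphM (real_complex R) (K ^+ 2)) /= -!tau_star_mul -tauZ.
apply: tau_op_le.
- by rewrite /selfadjoint starM starK.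
- by rewrite /selfadjoint starZ starM starK [Num.conj _]conjc_real.
move=> z; rewrite -scaleN1r addrC vN_rep_linear linearDl /= linearZl_LR /=.
have rep_sq c : hdot (vN_rep (star c * c) z) z = `|vN_rep c z| ^+ 2.
  by rewrite vN_repM /= vN_rep_star starK hdot_norm.
have repZ c d : vN_rep (c *: d) z = c *: vN_rep d z.
  by have := vN_rep_linear c d 0 z; rewrite vN_rep0 !addr0.
rewrite repZ linearZl_LR /= !rep_sq mulN1r addrC subr_ge0 vN_repM /=.
rewrite rmorphXn /= -rE -exprMn ler_pXn2r // ?nnegrE ?mulr_ge0 //; last exact: ltW.
exact: fr.
Qed.

Lemma opbW a K x : opb a K -> n2 (a * x) <= K * n2 x.
Proof. by case=> _. Qed.

Lemma opb_n2 a K : opb a K -> n2 a <= K.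
Proof. by move=> /opbW-/(_ 1); rewrite mulr1 n21 mulr1. Qed.

Lemma opb_le a K K' : K <= K' -> opb a K -> opb a K'.
Proof.
move=> KK' [K0 aK]; split=> [|x]; first exact: le_trans KK'.
by rewrite (le_trans (aK x)) // ler_wpM2r ?n2_ge0.
Qed.

Lemma opb1 : opb 1 1.
Proof. by split=> // x; rewrite !mul1r. Qed.

Lemma opbM a b K K' : opb a K -> opb b K' -> opb (a * b) (K * K').
Proof.
move=> [K0 aK] [K'0 bK]; split=> [|x]; first exact: mulr_ge0.
by rewrite -!mulrA (le_trans (aK _)) // ler_wpM2l.
Qed.

(** By duality: for y = a^* x, ||y||_2^2 = tau(x^* a y) <= ||x||_2 K ||y||_2. *)
Lemma opb_star a K : opb a K -> opb (star a) K.
Proof.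
move=> [K0 aK]; split=> // x; set y := star a * x.
have [->|y0] := eqVneq (n2 y) 0; first by rewrite mulr_ge0 // n2_ge0.
have {}y0 : 0 < n2 y by rewrite lt_def y0 n2_ge0.
rewrite -(ler_pM2r y0) -expr2.
have -> : n2 y ^+ 2 = complex.Re (tau (star x * (a * y))).
  by rewrite mulrA -[X in _ * X * _]starK -starM tau_star_mul.
apply: le_trans (Re_le_absc _) _; apply: le_trans (absc_tauM _ _) _.
by rewrite n2_star -mulrA mulrCA ler_wpM2l ?n2_ge0.
Qed.

(** Traciality makes the adjoint isometric for the 2-norm, so bounds on the left transfer to the
    right. *)
Lemma opb_mulr a K x : opb a K -> n2 (x * a) <= K * n2 x.
Proof. by move=> /opb_star aK; rewrite -n2_star starM -(n2_star x); exact: opbW. Qed.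

Lemma opbZ (c : R[i]) a K : opb a K -> opb (c *: a) (absc c * K).
Proof.
move=> [K0 aK]; split=> [|x]; first by rewrite mulr_ge0 ?absc_ge0.
by rewrite -scalerAl n2Z -mulrA ler_wpM2l ?absc_ge0.
Qed.

Lemma opbX a K k : opb a K -> opb (a ^+ k) (K ^+ k).
Proof.
move=> aK; elim: k => [|k IH]; first by rewrite !expr0; exact: opb1.
by rewrite !exprS; exact: opbM.
Qed.

End Tracial.

(** * Powers of the defect of a contraction *)

Lemma cvg_sqr0 (R : realType) (x : nat -> R) : (forall k, 0 <= x k) ->
  x k ^+ 2 @[k --> \oo] --> (0 : R) -> x k @[k --> \oo] --> (0 : R).
Proof.
move=> x0 xx; rewrite -(@sqrtr0 R).
rewrite (_ : x = (fun k => Num.sqrt (x k ^+ 2))); last first.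
  by apply/funext => k; rewrite sqrtr_sqr ger0_norm.
exact: (continuous_cvg _ (@sqrt_continuous R 0) xx).
Qed.

(* For a contraction p the powers of 1 - p p^* converge in L^2 to the projection
   onto the kernel of p^*. *)
Section DefectPowers.
Variables (R : realType) (M : tracialWstar R) (L : L2space M).
Local Notation n2 := (n2 L).
Local Notation opb := (opb L).
Implicit Types p x : M.

Definition defect p : M := 1 - p * star p.

Lemma defect_sa p : selfadjoint (defect p).
Proof. by rewrite /selfadjoint starB star1 starM starK. Qed.

Lemma defectX_sa p k : star (defect p ^+ k) = defect p ^+ k.
Proof. by rewrite starX defect_sa. Qed.

(** Expanding the square gives ||x||^2 - 2 ||p^* x||^2 + ||p p^* x||^2, where the last term is at
    most ||p^* x||^2. *)
Lemma defect_n2_sqr p x : opb p 1 ->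
  n2 (defect p * x) ^+ 2 + n2 (star p * x) ^+ 2 <= n2 x ^+ 2.
Proof.
move=> p1.
have E : tau (x * star (p * (star p * x))) = (n2 (star p * x) ^+ 2)%:C.
  by rewrite starM mulrA tau_trace mulrA (tau_mul_star L).
rewrite mulrBl mul1r -mulrA n2B_sqr E /=.
have : n2 (p * (star p * x)) <= n2 (star p * x).
  by rewrite -[leRHS]mul1r; exact: opbW.
by move: (n2_ge0 L (p * (star p * x))) (n2_ge0 L (star p * x)); nra.
Qed.

Lemma defect_opb p : opb p 1 -> opb (defect p) 1.
Proof.
move=> p1; split=> // x; rewrite mul1r -(@ler_pXn2r _ 2) // ?nnegrE ?n2_ge0 //.
by apply: le_trans _ (defect_n2_sqr x p1); rewrite lerDl sqr_ge0.
Qed.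

Lemma defectX_opb p k : opb p 1 -> opb (defect p ^+ k) 1.
Proof. by move=> /defect_opb /(opbX k); rewrite expr1n. Qed.

Lemma defect_n2_ni p : opb p 1 ->
  nonincreasing_seq (fun k => n2 (defect p ^+ k) ^+ 2).
Proof.
move=> p1; apply/nonincreasing_seqP => k.
rewrite (exprS _ k); apply: le_trans _ (defect_n2_sqr _ p1).
by rewrite lerDl sqr_ge0.
Qed.

Lemma defect_n2_lb p : has_lbound (range (fun k => n2 (defect p ^+ k) ^+ 2)).
Proof. by exists 0 => _ [k _ <-]; rewrite sqr_ge0. Qed.

Lemma defect_n2_cvg p : opb p 1 -> cvgn (fun k => n2 (defect p ^+ k) ^+ 2).
Proof.
move=> p1; apply: nonincreasing_is_cvgn; first exact: defect_n2_ni.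
exact: defect_n2_lb.
Qed.

(** By [defect_n2_sqr] the terms are at most the decrements of a convergent sequence. In the limit,
    p^* annihilates the projection. *)
Lemma defect_n2_star_cvg0 p : opb p 1 ->
  n2 (star p * defect p ^+ k) ^+ 2 @[k --> \oo] --> (0 : R).
Proof.
move=> p1; have sc := defect_n2_cvg p1.
set s := fun k => _ in sc.
apply: (@squeeze_cvgr _ _ _ _ (fun=> 0) (fun k => s k - s k.+1)).
- near=> k; rewrite sqr_ge0 /= lerBrDl /s (exprS _ k); exact: defect_n2_sqr.
- exact: cvg_cst.
rewrite -(subrr (limn s)); apply: cvgB => //.
by rewrite -(cvg_shiftS s (nbhs (limn s))) in sc.
Unshelve. all: by end_near. Qed.

(** With even exponents every inner product of two powers is itself a term of the monotone sequence
    of squared norms. *)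
Lemma defect_tau p k l :
  tau (defect p ^+ (k + k) * star (defect p ^+ (l + l))) =
  (n2 (defect p ^+ (k + l)) ^+ 2)%:C.
Proof.
rewrite -(tau_mul_star L) !defectX_sa -!exprD; congr (tau (_ ^+ _)).
by rewrite addnACA.
Qed.

Lemma defect_tau1 p k : tau (defect p ^+ (k + k)) = (n2 (defect p ^+ k) ^+ 2)%:C.
Proof. by have := defect_tau p k 0; rewrite !addn0 expr0 star1 mulr1. Qed.

(** Cauchy criterion: with s k the squared norm of the k-th power, the squared distance is s(2N) +
    s(2k) - 2 s(N+k), which is small because s decreases to a limit. *)
Lemma defect_L2_cvg p : opb p 1 ->
  cvg (L2_inj L (defect p ^+ (k + k)) @[k --> \oo]).
Proof.
move=> p1; apply/cauchy_cvgP/cauchy_exP => e e0.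
have eE : e = (complex.Re e)%:C by rewrite RRe_real // realE ltW.
have re0 : 0 < complex.Re e by rewrite -ltcR -eE.
set r := complex.Re e in eE re0.
set s := fun k => n2 (defect p ^+ k) ^+ 2.
have s_ni : nonincreasing_seq s by exact: defect_n2_ni.
have sc : cvgn s by exact: defect_n2_cvg.
have r20 : 0 < r ^+ 2 / 2 by rewrite divr_gt0 // exprn_gt0.
have [N _ sN] : \forall k \near \oo, `|s k - limn s| < r ^+ 2 / 2.
  by move/cvgrPdistC_lt: sc; apply.
exists (L2_inj L (defect p ^+ (N + N))), N => // k /= Nk.
rewrite /= -ball_normE /= -linearB norm_hnm eE ltcR -/(n2 _).
rewrite -(@ltr_pXn2r _ 2) // ?nnegrE ?n2_ge0 ?(ltW re0) // n2B_sqr defect_tau /=.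
have := sN N (leqnn N); rewrite ltr_norml => /andP[_].
have := nonincreasing_cvgn_ge s_ni sc (N + k).
have := s_ni _ _ (leq_addr N N); have := s_ni _ _ (leq_trans Nk (leq_addr k k)).
rewrite /s; lra.
Qed.

(** The intertwining p (1 - p^* p)^m = (1 - p p^* )^m p and traciality; this is the polynomial form
    of the equality of the traces of the two kernel projections. *)
Lemma defect_swap p k : tau (defect (star p) ^+ k) = tau (defect p ^+ k).
Proof.
have comm m : p * defect (star p) ^+ m = defect p ^+ m * p.
  elim: m => [|m IH]; first by rewrite !expr0 mulr1 mul1r.
  rewrite exprSr mulrA IH exprSr -!mulrA; congr (_ * _).
  by rewrite /defect starK mulrBr mulrBl mulr1 mul1r mulrA.
elim: k => [|k IH]; first by rewrite !expr0.
rewrite !exprSr {2 4}/defect starK !mulrBr !mulr1 !tauB IH; congr (_ - _).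
by rewrite mulrA tau_trace mulrA comm mulrA.
Qed.

Lemma defect_n2_swap p k : n2 (defect (star p) ^+ k) = n2 (defect p ^+ k).
Proof.
apply/eqP; rewrite -(@eqrXn2 _ 2) ?n2_ge0 //; apply/eqP/complexI.
by rewrite -!defect_tau1 defect_swap.
Qed.

(** An x almost killed by p is almost fixed by b = 1 - p^* p: the difference telescopes into k terms
    b^i p^* p x, each of norm at most ||p x||_2. *)
Lemma defect_telescope p k x : opb p 1 ->
  n2 (x - defect (star p) ^+ k * x) <= k%:R * n2 (p * x).
Proof.
move=> p1; elim: k => [|k IH]; first by rewrite expr0 mul1r subrr n20 mul0r.
set b := defect _; have -> : x - b ^+ k.+1 * x =
    (x - b ^+ k * x) + b ^+ k * (star p * (p * x)).
  have -> : star p * (p * x) = x - b * x.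
    by rewrite mulrBl mul1r starK mulrA opprB addrC subrK.
  by rewrite mulrBr mulrA -exprSr addrA subrK.
apply: le_trans (n2D _ _ _) _; rewrite -natr1 mulrDl mul1r lerD //.
apply: le_trans (opbW _ (defectX_opb k (opb_star p1))) _; rewrite mul1r.
by rewrite -[leRHS]mul1r; exact/opbW/opb_star.
Qed.

End DefectPowers.

(** * Words as a basis of the free algebra *)

Section LinearExtension.
Variables (R : realType) (n : nat).
Local Notation A := (ncpoly R n).

Definition ncmon (w : seq 'I_n) : A := mkmalgU (FMonom w) 1.

Lemma ncmon_cat v w : ncmon (v ++ w) = ncmon v * ncmon w.
Proof.
rewrite [RHS]mkmalgUM mulr1; congr (mkmalgU _ _).
by rewrite -[RHS]fmK fmM.
Qed.

Lemma ncmon_nil : ncmon [::] = 1.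
Proof. by rewrite /ncmon -fmoneE. Qed.

Variable V : lmodType R[i].
Implicit Types (f g : seq 'I_n -> V).

Definition lext f (P : A) : V :=
  \sum_(w <- msupp P) mcoeff w P *: f (fmonom_val w).

Lemma lextEw f (d : finset_of (Phant (fmonom 'I_n))) P :
  fsubset (msupp P) d ->
  lext f P = \sum_(w <- d) mcoeff w P *: f (fmonom_val w).
Proof.
move=> le; rewrite [LHS](big_fset_incl _ le) // => w _.
by rewrite -mcoeff_eq0 => /eqP->; rewrite scale0r.
Qed.

Lemma lext_is_linear f : linear (lext f).
Proof.
move=> c P Q; pose d := fsetU (msupp P) (msupp Q).
have sP : fsubset (msupp P) d by exact: fsubsetUl.
have sQ : fsubset (msupp Q) d by exact: fsubsetUr.
have sPQ : fsubset (msupp (c *: P + Q)) d.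
  apply: (fsubset_trans (msuppD_le _ _)).
  exact: fsetUSS (msuppZ_le _ _) (fsubset_refl _).
rewrite (lextEw _ sPQ) (lextEw _ sP) (lextEw _ sQ) scaler_sumr -big_split /=.
by apply: eq_bigr => w _; rewrite mcoeffD mcoeffZ scalerDl scalerA.
Qed.

Lemma lext_mon f w : lext f (ncmon w) = f w.
Proof.
rewrite (lextEw f (msuppU_le (k := FMonom w) (x := 1))).
by rewrite big_seq_fset1 mcoeffUU scale1r.
Qed.

End LinearExtension.

(* The free algebra on n self-adjoint generators as an interface over a sealed
   carrier: unification never has to look inside the monoid algebra. *)
Record freeStarAlg (R : realType) (n : nat) := FreeStarAlg {
  fa_alg :> lalgType R[i] ;
  fa_mon : seq 'I_n -> fa_alg ;
  fa_supp : fa_alg -> seq (seq 'I_n) ;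
  fa_coef : seq 'I_n -> fa_alg -> R[i] ;
  fa_star : fa_alg -> fa_alg ;
  fa_mon_nil : fa_mon [::] = 1 ;
  fa_mon_cat : forall v w, fa_mon (v ++ w) = fa_mon v * fa_mon w ;
  fa_scalerAr : forall (c : R[i]) (P Q : fa_alg), P * (c *: Q) = c *: (P * Q) ;
  fa_expand : forall P, P = \sum_(w <- fa_supp P) fa_coef w P *: fa_mon w ;
  fa_coef_linear : forall w c P Q,
    fa_coef w (c *: P + Q) = c * fa_coef w P + fa_coef w Q ;
  fa_coef_mon : forall v w, fa_coef v (fa_mon w) = (w == v)%:R ;
  fa_coef_supp : forall w P, w \in fa_supp P -> fa_coef w P != 0 ;
  fa_ext_linear : forall (V : lmodType R[i]) (f : seq 'I_n -> V),
    linear (fun P => \sum_(w <- fa_supp P) fa_coef w P *: f w) ;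
  fa_ext_mon : forall (V : lmodType R[i]) (f : seq 'I_n -> V) v,
    \sum_(w <- fa_supp (fa_mon v)) fa_coef w (fa_mon v) *: f w = f v ;
  fa_starD : forall P Q, fa_star (P + Q) = fa_star P + fa_star Q ;
  fa_starZmon : forall c w,
    fa_star (c *: fa_mon w) = Num.conj c *: fa_mon (rev w)
}.

Section NcpolyFree.
Variables (R : realType) (n : nat).
Local Notation A := (ncpoly R n).

Definition ncsupp (P : A) : seq (seq 'I_n) :=
  [seq fmonom_val w | w <- enum_fset (msupp P)].

Lemma ncsuppE (V : lmodType R[i]) (f : seq 'I_n -> V) P :
  \sum_(w <- ncsupp P) mcoeff (FMonom w) P *: f w = lext f P.
Proof. by rewrite /ncsupp big_map; apply: eq_bigr => -[w]. Qed.

(** The coefficient map of [ncstar] is conjugation followed by the unit embedding; packing it as an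
    additive map makes the lemmas on [mmap] applicable. *)
Lemma ncstar_additive : exists F : {additive A -> A},
  @ncstar R n = F /\
  forall c w, F (c *: ncmon R w) = Num.conj c *: ncmon R (rev w).
Proof.
pose f (c : R[i]) : A := (Num.conj c)%:A.
have fB : zmod_morphism f by move=> c d; rewrite /f rmorphB scalerBl.
pose F := GRing.isZmodMorphism.Build _ _ f fB.
pose fA : {additive R[i] -> A} := HB.pack f F.
pose h := fun w : fmonom 'I_n => mkmalgU (FMonom (rev w)) 1 : A.
exists (mmap fA h); split=> // c w; rewrite -mkmalgUZ.
exact: etrans (@mmapU _ _ _ fA h c (FMonom w)) (mulr_algl _ _).
Qed.

Lemma ncstarD (P Q : A) : ncstar (P + Q) = ncstar P + ncstar Q.
Proof. by have [F [-> _]] := ncstar_additive; exact: raddfD. Qed.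

Lemma ncstarZmon c (w : seq 'I_n) :
  ncstar (c *: ncmon R w) = Num.conj c *: ncmon R (rev w).
Proof. by have [F [-> E]] := ncstar_additive; exact: E. Qed.

Lemma ncpoly_expand P : P = \sum_(w <- ncsupp P) mcoeff (FMonom w) P *: ncmon R w.
Proof.
rewrite {1}(monalgE P) /ncsupp big_map; apply: eq_bigr => -[w] _.
exact: mkmalgUZ.
Qed.

Lemma ncpoly_coef_linear w c (P Q : A) :
  mcoeff (FMonom w) (c *: P + Q) =
  c * mcoeff (FMonom w) P + mcoeff (FMonom w) Q.
Proof. by rewrite mcoeffD mcoeffZ. Qed.

Lemma ncpoly_coef_mon (v w : seq 'I_n) :
  mcoeff (FMonom v) (ncmon R w) = (w == v)%:R.
Proof. by rewrite mcoeffU. Qed.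

Lemma ncpoly_coef_supp w (P : A) : w \in ncsupp P -> mcoeff (FMonom w) P != 0.
Proof. by case/mapP => -[u] uP ->; rewrite mcoeff_neq0. Qed.

Lemma ncpoly_ext_linear (V : lmodType R[i]) (f : seq 'I_n -> V) :
  linear (fun P => \sum_(w <- ncsupp P) mcoeff (FMonom w) P *: f w).
Proof. by move=> c P Q; rewrite !ncsuppE; exact: lext_is_linear. Qed.

Lemma ncpoly_ext_mon (V : lmodType R[i]) (f : seq 'I_n -> V) v :
  \sum_(w <- ncsupp (ncmon R v)) mcoeff (FMonom w) (ncmon R v) *: f w = f v.
Proof. by rewrite ncsuppE; exact: lext_mon. Qed.

Definition ncpoly_free : freeStarAlg R n := FreeStarAlg
  (ncmon_nil R n) (@ncmon_cat R n) (@malg_scalerAr R _) ncpoly_expand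
  ncpoly_coef_linear ncpoly_coef_mon ncpoly_coef_supp ncpoly_ext_linear
  ncpoly_ext_mon ncstarD ncstarZmon.

End NcpolyFree.

(** * Coefficients, adjoint, evaluation and difference quotients in the free algebra *)

Section FreeAlgebra.
Variables (R : realType) (n : nat) (F : freeStarAlg R n).
Implicit Types (P Q : F) (v w : seq 'I_n).
Local Notation mon := (fa_mon F).

Lemma fa_ind (Pr : F -> Prop) :
  Pr 0 -> (forall P Q, Pr P -> Pr Q -> Pr (P + Q)) ->
  (forall c w, Pr (c *: mon w)) -> forall P, Pr P.
Proof. by move=> P0 PD PU P; rewrite (fa_expand P); apply: big_ind. Qed.

Definition ext (V : lmodType R[i]) (f : seq 'I_n -> V) P :=
  \sum_(w <- fa_supp P) fa_coef w P *: f w.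

HB.instance Definition _ (V : lmodType R[i]) (f : seq 'I_n -> V) :=
  GRing.isLinear.Build _ _ _ _ (ext f) (fa_ext_linear f).

Lemma ext_mon (V : lmodType R[i]) (f : seq 'I_n -> V) w : ext f (mon w) = f w.
Proof. exact: fa_ext_mon. Qed.

Lemma fa_coefZ w c P : fa_coef w (c *: P) = c * fa_coef w P.
Proof.
have := fa_coef_linear w c P 0; have := fa_coef_linear w (-1) (0 : F) 0.
by rewrite scaler0 addr0 mulN1r addNr => ->; rewrite !addr0.
Qed.

Lemma fa_coefD w P Q : fa_coef w (P + Q) = fa_coef w P + fa_coef w Q.
Proof. by have := fa_coef_linear w 1 P Q; rewrite scale1r mul1r. Qed.

Lemma fa_coef0 w : fa_coef w (0 : F) = 0.
Proof. by rewrite -[X in fa_coef w X](scale0r (0 : F)) fa_coefZ mul0r. Qed.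

Lemma fa_coef_sum w (s : seq (seq 'I_n)) (G : seq 'I_n -> F) :
  fa_coef w (\sum_(v <- s) G v) = \sum_(v <- s) fa_coef w (G v).
Proof. exact: (big_morph _ (fa_coefD w) (fa_coef0 w)). Qed.

Lemma coef_neq0_supp w P : fa_coef w P != 0 -> w \in fa_supp P.
Proof.
apply: contraR => wP; rewrite [in X in fa_coef w X](fa_expand P) fa_coef_sum.
rewrite big1_seq // => v /andP[_ vP]; rewrite fa_coefZ fa_coef_mon.
by case: eqVneq => [vw|_]; [rewrite -vw vP in wP|rewrite mulr0].
Qed.

Lemma fa_coef_eq0 P : (forall w, fa_coef w P = 0) -> P = 0.
Proof.
by move=> P0; rewrite (fa_expand P) big1 // => w _; rewrite P0 scale0r.
Qed.

Lemma fa_const P : (forall v, (0 < size v)%N -> fa_coef v P = 0) ->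
  P = fa_coef [::] P *: 1.
Proof.
move=> P0; suff [c Pc] : exists c : R[i], P = c *: 1.
  by rewrite {2}Pc fa_coefZ -(fa_mon_nil F) fa_coef_mon eqxx mulr1 fa_mon_nil.
have : {in fa_supp P, forall w, w = [::]}.
  move=> w /fa_coef_supp; case: (posnP (size w)) => [/size0nil //|/P0->].
  by rewrite eqxx.
rewrite [in X in _ -> X](fa_expand P).
elim: (fa_supp P) => [|w s IH] sE; first by exists 0; rewrite big_nil scale0r.
have [|c sc] := IH; first by move=> v vs; apply: sE; rewrite inE vs orbT.
exists (fa_coef w P + c).
rewrite big_cons (sE w) ?mem_head // fa_mon_nil scalerDl.
by congr (_ + _).
Qed.

Lemma fa_star0 : fa_star (0 : F) = 0.
Proof. by apply: (addrI (fa_star (0 : F))); rewrite -fa_starD !addr0. Qed.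

Lemma fa_starZ c P : fa_star (c *: P) = Num.conj c *: fa_star P.
Proof.
elim/fa_ind: P => [|P Q eP eQ|d w].
- by rewrite scaler0 fa_star0 scaler0.
- by rewrite scalerDr !fa_starD eP eQ scalerDr.
by rewrite scalerA !fa_starZmon rmorphM scalerA.
Qed.

Lemma fa_starB P Q : fa_star (P - Q) = fa_star P - fa_star Q.
Proof. by rewrite fa_starD -scaleN1r fa_starZ rmorphN rmorph1 scaleN1r. Qed.

Lemma fa_star_mon w : fa_star (mon w) = mon (rev w).
Proof. by rewrite -[mon w]scale1r fa_starZmon rmorph1 scale1r. Qed.

Lemma fa_starK P : fa_star (fa_star P) = P.
Proof.
elim/fa_ind: P => [|P Q eP eQ|c w]; first by rewrite !fa_star0.
  by rewrite !fa_starD eP eQ.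
by rewrite !fa_starZmon conjCK revK.
Qed.

Lemma fa_starM P Q : fa_star (P * Q) = fa_star Q * fa_star P.
Proof.
elim/fa_ind: P => [|P P' eP eP'|c v].
- by rewrite mul0r fa_star0 mulr0.
- by rewrite mulrDl !fa_starD eP eP' mulrDr.
rewrite -scalerAl !fa_starZ fa_scalerAr; congr (_ *: _).
elim/fa_ind: Q => [|Q Q' eQ eQ'|d w].
- by rewrite mulr0 fa_star0 mul0r.
- by rewrite mulrDr !fa_starD eQ eQ' mulrDl.
rewrite fa_scalerAr !fa_starZ -scalerAl; congr (_ *: _).
by rewrite -fa_mon_cat !fa_star_mon rev_cat fa_mon_cat.
Qed.

Lemma fa_star1 : fa_star (1 : F) = 1.
Proof. by rewrite -(fa_mon_nil F) fa_star_mon. Qed.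

Lemma fa_starX P k : fa_star (P ^+ k) = fa_star P ^+ k.
Proof.
elim: k => [|k IH]; first by rewrite !expr0 fa_star1.
by rewrite exprS fa_starM IH exprSr.
Qed.

Section Evaluation.
Variables (B : algType R[i]) (X : 'I_n -> B).

Definition wev w : B := \prod_(i <- w) X i.

Lemma wev_cons i w : wev (i :: w) = X i * wev w.
Proof. exact: big_cons. Qed.

Lemma wev_cat v w : wev (v ++ w) = wev v * wev w.
Proof. exact: big_cat. Qed.

Lemma wev_nil : wev [::] = 1.
Proof. exact: big_nil. Qed.

Definition ev := ext wev.
HB.instance Definition _ := GRing.Linear.on ev.

Lemma ev_mon w : ev (mon w) = wev w.
Proof. exact: ext_mon. Qed.

Lemma evM P Q : ev (P * Q) = ev P * ev Q.
Proof.
elim/fa_ind: P => [|P P' eP eP'|c v].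
- by rewrite mul0r linear0 mul0r.
- by rewrite mulrDl !linearD /= eP eP' mulrDl.
rewrite -scalerAl !linearZ /= -scalerAl; congr (_ *: _).
elim/fa_ind: Q => [|Q Q' eQ eQ'|d w].
- by rewrite mulr0 linear0 mulr0.
- by rewrite mulrDr !linearD /= eQ eQ' mulrDr.
rewrite fa_scalerAr !linearZ /= -scalerAr; congr (_ *: _).
by rewrite -fa_mon_cat !ev_mon wev_cat.
Qed.

Lemma ev1 : ev 1 = 1.
Proof. by rewrite -(fa_mon_nil F) ev_mon wev_nil. Qed.

Lemma evX P k : ev (P ^+ k) = ev P ^+ k.
Proof. by elim: k => [|k IH]; [exact: ev1|rewrite !exprS evM IH]. Qed.

End Evaluation.

Lemma ev_star (B : starAlgType R) (X : 'I_n -> B) P :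
  (forall i, selfadjoint (X i)) -> ev X (fa_star P) = star (ev X P).
Proof.
move=> sX; elim/fa_ind: P => [|P Q eP eQ|c w].
- by rewrite fa_star0 linear0 star0.
- by rewrite fa_starD !linearD /= starD eP eQ.
rewrite fa_starZmon !linearZ /= starZ !ev_mon; congr (_ *: _).
elim: w => [|i w IH]; first by rewrite wev_nil star1.
by rewrite rev_cons -cats1 wev_cat IH !wev_cons wev_nil mulr1 starM sX.
Qed.

(* The slices (id (x) phi) d_j and (phi (x) id) d_j of the free difference
   quotient, for a functional phi given by its values on words. *)
Section Slices.
Variable j : 'I_n.
Implicit Types phi psi : seq 'I_n -> R[i].

(** Here phi eats the left leg: in d_j (Z_i v) = delta_ij 1 (x) v + (Z_i (x) 1) d_j v, the letter
    Z_i moves into the argument of phi. *)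
Fixpoint sliceL phi w : F :=
  if w is i :: v then
    ((i == j)%:R * phi [::]) *: mon v + sliceL (fun u => phi (i :: u)) v
  else 0.

(** Here phi eats the right leg, so the letter Z_i stays outside as a left factor. *)
Fixpoint sliceR phi w : F :=
  if w is i :: v then
    ((i == j)%:R * phi v) *: mon [::] + mon [:: i] * sliceR phi v
  else 0.

Definition dL phi := ext (sliceL phi).
Definition dR phi := ext (sliceR phi).
HB.instance Definition _ phi := GRing.Linear.on (dL phi).
HB.instance Definition _ phi := GRing.Linear.on (dR phi).

Lemma dL_mon phi w : dL phi (mon w) = sliceL phi w.
Proof. exact: ext_mon. Qed.

Lemma dR_mon phi w : dR phi (mon w) = sliceR phi w.
Proof. exact: ext_mon. Qed.

Lemma sliceL_linear c phi psi w :
  sliceL (fun u => c * phi u + psi u) w = c *: sliceL phi w + sliceL psi w.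
Proof.
elim: w phi psi => [|i w IH] phi psi /=; first by rewrite scaler0 addr0.
rewrite (IH (fun u => phi (i :: u)) (fun u => psi (i :: u))).
by rewrite mulrDr scalerDl scalerDr scalerA [_ * (c * _)]mulrCA addrACA.
Qed.

Lemma dL_linear_phi (c : R[i]) phi psi P :
  dL (fun w => c * phi w + psi w) P = c *: dL phi P + dL psi P.
Proof.
elim/fa_ind: P => [|P Q eP eQ|d w].
- by rewrite !linear0 addr0.
- by rewrite !linearD /= eP eQ addrACA.
by rewrite !linearZ /= -scalerDr !dL_mon sliceL_linear.
Qed.

Lemma sliceR_linear c phi psi w :
  sliceR (fun u => c * phi u + psi u) w = c *: sliceR phi w + sliceR psi w.
Proof.
elim: w => [|i w IH] /=; first by rewrite scaler0 addr0.
rewrite IH (mulrDr (mon _)) fa_scalerAr.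
by rewrite mulrDr scalerDl scalerDr scalerA [_ * (c * _)]mulrCA addrACA.
Qed.

Lemma sliceL_cat phi v w :
  sliceL phi (v ++ w) = sliceL phi v * mon w + sliceL (fun u => phi (v ++ u)) w.
Proof.
elim: v phi => [|i v IH] phi /=; first by rewrite mul0r add0r.
by rewrite IH fa_mon_cat mulrDl addrA -scalerAl.
Qed.

Lemma sliceR_cat phi v w :
  sliceR phi (v ++ w) = sliceR (fun u => phi (u ++ w)) v + mon v * sliceR phi w.
Proof.
elim: v => [|i v IH] /=; first by rewrite fa_mon_nil mul1r add0r.
by rewrite IH mulrDr addrA -(cat1s i v) fa_mon_cat mulrA.
Qed.

Lemma dL_monM phi i Q : dL phi (mon [:: i] * Q) =
  ((i == j)%:R * phi [::]) *: Q + dL (fun u => phi (i :: u)) Q.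
Proof.
elim/fa_ind: Q => [|P Q eP eQ|c w].
- by rewrite mulr0 !linear0 addr0.
- by rewrite mulrDr !linearD /= eP eQ addrACA.
rewrite fa_scalerAr -fa_mon_cat !linearZ /= !dL_mon /= scalerDr !scalerA.
by rewrite [c * _]mulrC.
Qed.

(* Coassociativity of the free difference quotient. *)
Lemma dL_dR phi psi P : dL phi (dR psi P) = dR psi (dL phi P).
Proof.
elim/fa_ind: P => [|P Q eP eQ|c w]; first by rewrite !linear0.
  by rewrite !linearD /= eP eQ.
rewrite !linearZ /= dL_mon dR_mon; congr (_ *: _).
elim: w phi => [|i w IH] phi /=; first by rewrite !linear0.
rewrite !linearD !linearZ /= dL_monM IH dL_mon /= scaler0 add0r.
by rewrite dR_mon.
Qed.

(** Reversing a word exchanges the two legs of each of its factorizations u Z_j v. *)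
Lemma star_sliceR phi w :
  fa_star (sliceR phi w) = sliceL (fun u => Num.conj (phi (rev u))) (rev w).
Proof.
elim: w => [|i w IH] /=; first exact: fa_star0.
rewrite fa_starD fa_starZ fa_starM IH !fa_star_mon (rev_cons i w) -cats1 sliceL_cat.
by rewrite addrC /= addr0 cats0 revK rmorphM rmorph_nat.
Qed.

Lemma star_dR phi P :
  fa_star (dR phi P) = dL (fun u => Num.conj (phi (rev u))) (fa_star P).
Proof.
elim/fa_ind: P => [|P Q eP eQ|c w].
- by rewrite linear0 !fa_star0 linear0.
- by rewrite linearD /= !fa_starD eP eQ linearD.
rewrite linearZ /= !fa_starZ linearZ /= fa_star_mon dR_mon dL_mon; congr (_ *: _).
exact: star_sliceR.
Qed.

Lemma coef_sliceL_small phi v w :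
  (size v <= size w)%N -> fa_coef w (sliceL phi v) = 0.
Proof.
elim: v phi => [|i v IH] phi /= vw; first exact: fa_coef0.
rewrite fa_coefD fa_coefZ fa_coef_mon IH 1?ltnW // addr0.
have [E|_] := eqVneq v w; last by rewrite mulr0.
by rewrite E ltnn in vw.
Qed.

Lemma coef_sliceL phi v w : (size v <= (size w).+1)%N ->
  fa_coef w (sliceL phi v) = phi [::] * (v == j :: w)%:R.
Proof.
case: v => [|i v] /= vw; first by rewrite fa_coef0 mulr0.
rewrite fa_coefD fa_coefZ fa_coef_mon coef_sliceL_small // addr0.
by rewrite eqseq_cons mulrAC -natrM mulnb mulrC.
Qed.

(** If no word of P is longer than j :: w, only that word can yield w, with an empty left leg. This
    keeps the sliced polynomial nonzero in the induction on the degree. *)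
Lemma coef_dL phi P w :
  (forall v, ((size w).+1 < size v)%N -> fa_coef v P = 0) ->
  fa_coef w (dL phi P) = phi [::] * fa_coef (j :: w) P.
Proof.
move=> bP; rewrite [in RHS](fa_expand P) !fa_coef_sum mulr_sumr.
apply: eq_big_seq => v vP; rewrite !fa_coefZ fa_coef_mon coef_sliceL.
  by rewrite mulrCA.
rewrite leqNgt; apply/negP => /bP vP0.
by have := fa_coef_supp vP; rewrite vP0 eqxx.
Qed.

End Slices.

End FreeAlgebra.

(** * Slices of the difference quotient by the trace *)

Section TraceSlices.
Variables (R : realType) (M : tracialWstar R) (L : L2space M) (n : nat).
Variables (F : freeStarAlg R n) (X : 'I_n -> M).
Hypothesis X_sa : forall i, selfadjoint (X i).
Variable j : 'I_n.
Implicit Types (P Q : F) (b c : M) (v w : seq 'I_n).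
Local Notation n2 := (n2 L).
Local Notation opb := (opb L).
Local Notation ev := (ev X).
Local Notation wev := (wev X).
Local Notation star' := (@fa_star R n F).

(** In tensor notation (id (x) tau(. c)) d_j; its companion [dLt b] is (tau(b .) (x) id) d_j. *)
Definition dRt c : F -> F := dR j (fun v => tau (wev v * c)).
Definition dLt b : F -> F := dL j (fun u => tau (b * wev u)).
HB.instance Definition _ c := GRing.Linear.on (dRt c).
HB.instance Definition _ b := GRing.Linear.on (dLt b).

Lemma dRt_linear (a : R[i]) b c P : dRt (a *: b + c) P = a *: dRt b P + dRt c P.
Proof.
elim/fa_ind: P => [|P Q eP eQ|d w].
- by rewrite !linear0 addr0.
- by rewrite !linearD /= eP eQ addrACA.
rewrite !linearZ /= -scalerDr; congr (_ *: _).
rewrite /dRt !dR_mon -sliceR_linear; congr (sliceR F j _ w).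
by apply/funext => v; rewrite mulrDr tauD -scalerAr tauZ.
Qed.

Lemma dRt0 P : dRt 0 P = 0.
Proof.
have := dRt_linear (-1) 0 0 P.
by rewrite scaler0 addr0 scaleN1r addNr.
Qed.

(** Leibniz rule: in the term with d_j P, the factor Q lies in the traced leg and joins the weight
    c. *)
Lemma dRtM c P Q : dRt c (P * Q) = dRt (ev Q * c) P + P * dRt c Q.
Proof.
elim/fa_ind: P => [|P P' eP eP'|a v].
- by rewrite !mul0r !linear0 addr0.
- by rewrite !mulrDl !linearD /= eP eP' addrACA.
rewrite -!scalerAl !linearZ /= -scalerDr; congr (_ *: _).
elim/fa_ind: Q => [|Q Q' eQ eQ'|d w].
- by rewrite mulr0 !linear0 mul0r dRt0 mulr0 addr0.
- rewrite mulrDr !linearD /= eQ eQ' mulrDl -[ev Q * c]scale1r dRt_linear.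
  by rewrite !scale1r mulrDr addrACA.
rewrite fa_scalerAr !linearZ /= fa_scalerAr -scalerAl -[d *: (_ * c)]addr0.
rewrite dRt_linear dRt0 addr0 -scalerDr; congr (_ *: _).
rewrite /dRt -fa_mon_cat !dR_mon sliceR_cat ev_mon; congr (sliceR F j _ v + _).
by apply/funext => u; rewrite wev_cat mulrA.
Qed.

(** Both sides are tau (x) tau of (b (x) 1) d_j P (1 (x) c), with the legs traced in different
    orders. *)
Lemma tau_dRt_dLt b c P : tau (b * ev (dRt c P)) = tau (ev (dLt b P) * c).
Proof.
elim/fa_ind: P => [|P Q eP eQ|a w].
- by rewrite !linear0 mulr0 mul0r.
- by rewrite !linearD /= mulrDr mulrDl !tauD eP eQ.
rewrite !linearZ /= -scalerAr -scalerAl !tauZ; congr (_ * _).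
rewrite /dRt /dLt dR_mon dL_mon.
elim: w b => [|i w IH] b /=; first by rewrite !linear0 mulr0 mul0r.
rewrite !linearD !linearZ /= !ev_mon evM ev_mon wev_cons wev_nil !mulr1.
rewrite mulrDr mulrDl !tauD -scalerAr mulr1 -scalerAl !tauZ.
congr (_ + _); first by rewrite mulrAC.
rewrite mulrA IH; congr (tau (ev (sliceL F j _ w) * c)).
by apply/funext => u; rewrite wev_cons mulrA.
Qed.

Lemma dLt_dRt b c P : dLt b (dRt c P) = dRt c (dLt b P).
Proof. exact: dL_dR. Qed.

Lemma wev_star w : star (wev (rev w)) = wev w.
Proof.
rewrite -(ev_mon F) -ev_star // fa_star_mon revK; exact: ev_mon.
Qed.

Lemma star_dRt c P : star' (dRt c P) = dLt (star c) (star' P).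
Proof.
rewrite /dRt star_dR; congr (dL j _ _); apply/funext => u.
by rewrite -(tau_star L) starM wev_star.
Qed.

Lemma dLt1_star P : dLt 1 P = star' (dRt 1 (star' P)).
Proof. by rewrite star_dRt star1 fa_starK. Qed.

(** A crude bound, with a constant depending on P; it only serves as the starting point for
    [dbound_apriori]. *)
Lemma dRt_bound P :
  exists2 C : R, 0 <= C & forall c, n2 (ev (dRt c P)) <= C * n2 c.
Proof.
elim/fa_ind: P => [|P Q [C C0 eP] [D D0 eQ]|a w].
- by exists 0 => // c; rewrite !linear0 n20 mul0r.
- exists (C + D) => [|c]; first exact: addr_ge0.
  by rewrite !linearD /= mulrDl (le_trans (n2D _ _ _)) // lerD.
suff [C C0 wC] : exists2 C : R, 0 <= C & forall c, n2 (ev (dRt c (fa_mon F w))) <= C * n2 c.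
  exists (absc a * C) => [|c]; first by rewrite mulr_ge0 ?absc_ge0.
  by rewrite !linearZ /= n2Z -mulrA ler_wpM2l ?absc_ge0.
elim: w => [|i w [C C0 IH]].
  by exists 0 => // c; rewrite /dRt dR_mon linear0 n20 mul0r.
have [K K0 iK] := opb_exists L (X i).
exists (n2 (wev w) + K * C) => [|c]; first by rewrite addr_ge0 ?n2_ge0 // mulr_ge0 // ltW.
rewrite /dRt dR_mon /= linearD linearZ /= ev_mon evM ev_mon wev_cons wev_nil mulr1.
rewrite (le_trans (n2D _ _ _)) // mulrDl lerD //.
  rewrite n2Z n21 mulr1; case: (i == j); last first.
    by rewrite mul0r (absc_real 0) normr0 mulr_ge0 ?n2_ge0.
  by rewrite mul1r absc_tauM.
apply: le_trans (opbW _ iK) _; rewrite -mulrA ler_wpM2l //; first exact: ltW.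
by have := IH c; rewrite /dRt dR_mon.
Qed.

(** Continuity of the slice in a functional small for the 2-norm, used to replace the kernel
    projection by its polynomial approximations. *)
Lemma dL_bound P : exists2 C : R, 0 <= C & forall phi (e : R), 0 <= e ->
  (forall u, absc (phi u) <= e * n2 (wev u)) -> n2 (ev (dL j phi P)) <= C * e.
Proof.
elim/fa_ind: P => [|P Q [C C0 eP] [D D0 eQ]|a w].
- by exists 0 => // phi e _ _; rewrite !linear0 n20 mul0r.
- exists (C + D) => [|phi e e0 phie]; first exact: addr_ge0.
  rewrite !linearD /= mulrDl (le_trans (n2D _ _ _)) // lerD //; first exact: eP.
  exact: eQ.
suff [C C0 wC] : exists2 C : R, 0 <= C & forall phi (e : R), 0 <= e ->
    (forall u, absc (phi u) <= e * n2 (wev u)) ->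
    n2 (ev (sliceL F j phi w)) <= C * e.
  exists (absc a * C) => [|phi e e0 phie]; first by rewrite mulr_ge0 ?absc_ge0.
  by rewrite !linearZ /= n2Z -mulrA ler_wpM2l ?absc_ge0 //= dL_mon; exact: wC.
elim: w => [|i w [C C0 IH]].
  by exists 0 => // phi e _ _; rewrite linear0 n20 mul0r.
have [K K0 iK] := opb_exists L (X i).
exists (n2 (wev w) + C * K) => [|phi e e0 phie].
  by rewrite addr_ge0 ?n2_ge0 // mulr_ge0 // ltW.
rewrite /= linearD linearZ /= ev_mon (le_trans (n2D _ _ _)) // mulrDl lerD //.
  rewrite n2Z mulrC ler_wpM2l ?n2_ge0 //; case: (i == j); last first.
    by rewrite mul0r (absc_real 0) normr0.
  by rewrite mul1r (le_trans (phie _)) // wev_nil n21 mulr1.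
(* The shifted functional phi (i :: u) satisfies the hypothesis with e K in place of e. *)
rewrite -mulrA; apply: IH => [|u]; first by rewrite mulr_ge0 // ltW.
rewrite (le_trans (phie _)) // wev_cons [K * e]mulrC -mulrA ler_wpM2l //.
exact: opbW.
Qed.

End TraceSlices.

(** * Dabrowski's inequality for the difference quotient *)

Section ConjugateVariable.
Variables (R : realType) (M : tracialWstar R) (L : L2space M) (n : nat).
Variables (F : freeStarAlg R n) (X : 'I_n -> M).
Hypothesis X_sa : forall i, selfadjoint (X i).
Variables (j : 'I_n) (xi : L).
Implicit Types (P Q B S U V : F) (a b c : M).
Local Notation n2 := (n2 L).
Local Notation opb := (opb L).
Local Notation ev := (ev X).
Local Notation dRt := (dRt X j).
Local Notation dLt := (dLt X j).
Local Notation star' := (@fa_star R n F).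
Local Notation psi := (L2_tau xi).

Hypothesis xi_conj : forall P, tau (ev (dRt 1 P)) = psi (ev P).
Hypothesis xi_gen :
  forall e : R, 0 < e -> exists P : F, hnm (xi - L2_inj L (ev P)) <= e.

Lemma psi_le a : absc (psi a) <= hnm xi * n2 a.
Proof. by apply: le_trans (cauchy_schwarz _ _) _; rewrite -(n2_star L a). Qed.

Lemma psi_approx x a :
  absc (psi a - tau (x * a)) <= hnm (xi - L2_inj L x) * n2 a.
Proof.
have -> : psi a - tau (x * a) = hdot (xi - L2_inj L x) (L2_inj L (star a)).
  by rewrite linearBl /= L2_dot starK.
by rewrite -(n2_star L a); exact: cauchy_schwarz.
Qed.

Lemma tau_dLt1 P : tau (ev (dLt 1 P)) = psi (ev P).
Proof. by rewrite -xi_conj -[in RHS](mul1r (ev _)) tau_dRt_dLt mulr1. Qed.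

(** The conjugate variable is self-adjoint: the adjoint only flips the legs of d_j, which tau (x)
    tau does not see. *)
Lemma psi_star P : psi (star (ev P)) = Num.conj (psi (ev P)).
Proof.
rewrite -ev_star // -tau_dLt1 -xi_conj -(tau_star L) -ev_star //.
by rewrite (star_dRt L) // star1.
Qed.

(** Voiculescu's formula d_j^* (P (x) 1) = P xi - (id (x) tau) d_j P, tested against B^*. *)
Lemma tau_dLt1M B P :
  tau (ev (dLt 1 B) * ev P) = psi (ev B * ev P) - tau (ev B * ev (dRt 1 P)).
Proof.
rewrite -(evM X B P) -xi_conj dRtM linearD tauD /= evM mulr1.
by rewrite -[ev (dRt (ev P) B)]mul1r tau_dRt_dLt addrK.
Qed.

(* ||d_j^* (P (x) 1)||_2 <= K, tested against the polynomials B^*. *)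
Definition dbound P (K : R) :=
  forall B, absc (tau (ev (dLt 1 B) * ev P)) <= K * n2 (ev B).

(** The added 1 leaves room for replacing xi by a nearby polynomial. *)
Let theta := hnm xi + 1.

Lemma theta_ge1 : 1 <= theta.
Proof. by rewrite lerDr hnm_ge0. Qed.

(* ||d_j^* (P (x) 1)||^2 = < d_j^* (P^* P (x) 1), xi >, where xi is replaced by a
   polynomial x close to it, hence d_j^* (P (x) 1) by y. *)
Lemma dbound_step P K K' : 0 < K -> 0 <= K' -> K * theta <= K' ^+ 2 ->
  dbound (star' P * P) K -> dbound P K'.
Proof.
move=> K0 K'0 KK' bPP B.
have [k k0 Pk] := opb_exists L (ev P).
set d := dRt 1 P; set D := dRt (ev P) (star' P).
pose Y := k * theta + n2 (ev d).
have Y0 : 0 <= Y by rewrite addr_ge0 ?n2_ge0 // mulr_ge0 ?ltW // (lt_le_trans _ theta_ge1).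
(* [C] and [E] are the coefficients of the approximation error [de] in [key] and in the final
   estimate. Since de C <= K, the bound K (hnm xi) + de C in [key] is at most K theta. *)
pose C := K + n2 (ev D) + k * Y.
have C0 : 0 < C by rewrite /C -addrA ltr_pwDl // addr_ge0 ?n2_ge0 // mulr_ge0 // ltW.
apply/ler_addgt0Pr => e e0.
pose E := k * n2 (ev B) + 1.
have E0 : 0 < E by rewrite ltr_wpDl // mulr_ge0 ?n2_ge0 // ltW.
pose de := Num.min 1 (Num.min (K / C) (e / E)).
have de0 : 0 < de by rewrite !lt_min ltr01 !divr_gt0.
have de1 : de <= 1 by rewrite ge_min lexx.
have deC : de * C <= K by rewrite -ler_pdivlMr // !ge_min lexx orbT.
have deE : de * E <= e by rewrite -ler_pdivlMr // !ge_min lexx !orbT.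
have [x xde] := xi_gen de0.
have nx : n2 (ev x) <= theta.
  have -> : n2 (ev x) = hnm (xi - (xi - L2_inj L (ev x))) by rewrite subKr.
  apply: le_trans (hnmD _ _) _; rewrite lerD2l -/(hnm _).
  by rewrite /hnm normrN -/(hnm _) (le_trans xde).
pose y := P * x - d.
have evy : ev y = ev P * ev x - ev d by rewrite linearB /= evM.
have nyY : n2 (ev y) <= Y.
  rewrite evy (le_trans (n2B _ _ _)) // lerD2r (le_trans (opbW _ Pk)) //.
  by rewrite ler_wpM2l // ltW.
have approx a : absc (psi a - tau (ev x * a)) <= de * n2 a.
  by apply: le_trans (psi_approx _ _) _; rewrite ler_wpM2r ?n2_ge0.
have EyB B' : absc (tau (ev (dLt 1 B') * ev P) - tau (ev y * ev B')) <=
    de * (k * n2 (ev B')).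
  rewrite tau_dLt1M evy mulrBl tauB [tau (ev d * _)]tau_trace.
  rewrite -mulrA [tau (ev P * _)]tau_trace -mulrA opprB addrA subrK.
  apply: le_trans (approx _) _; rewrite ler_wpM2l ?(ltW de0) //.
  exact: opb_mulr.
have key : n2 (ev y) ^+ 2 <= K * theta.
  have sy : star' y = star' x * star' P - star' d by rewrite fa_starB fa_starM.
  (* The Leibniz rule on x^* P^* moves P^* next to P, and coassociativity turns the d^* part into
     psi of [D]. The two terms in [D] nearly cancel since xi is self-adjoint. *)
  have E1 : tau (ev (dLt 1 (star' y)) * ev P) =
      tau (ev (dLt 1 (star' x)) * ev (star' P * P)) +
      (tau (star (ev x) * ev D) - psi (ev D)).
    rewrite -![tau (ev (dLt 1 _) * _)]tau_dRt_dLt !mul1r sy linearB linearB /=.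
    rewrite tauB dRtM linearD tauD /= !evM -addrA; congr (_ + (_ - _)).
      by rewrite ev_star.
    by rewrite (star_dRt L) // star1 -dLt_dRt tau_dLt1.
  have E2 : absc (tau (star (ev x) * ev D) - psi (ev D)) <= de * n2 (ev D).
    rewrite -absc_conj rmorphB /= -psi_star -(tau_star L) starM starK.
    by rewrite tau_trace -abscN opprB -(n2_star L (ev D)).
  have E3 : absc (tau (ev (dLt 1 (star' x)) * ev (star' P * P))) <= K * n2 (ev x).
    by apply: le_trans (bPP _) _; rewrite ev_star // n2_star.
  have E4 := EyB (star' y).
  rewrite ev_star // n2_star (tau_mul_star L) in E4.
  have E5 : n2 (ev y) ^+ 2 <= K * n2 (ev x) + de * n2 (ev D) + de * (k * n2 (ev y)).
    rewrite -[leLHS]ger0_norm ?sqr_ge0 // -absc_real.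
    rewrite -[X in absc X](subKr (tau (ev (dLt 1 (star' y)) * ev P))).
    apply: le_trans (abscB _ _) _; rewrite lerD // E1.
    by apply: le_trans (abscD _ _) _; rewrite lerD.
  have nx' : n2 (ev x) <= hnm xi + de.
    have -> : n2 (ev x) = hnm (xi - (xi - L2_inj L (ev x))) by rewrite subKr.
    by apply: le_trans (hnmD _ _) _; rewrite lerD2l /hnm normrN.
  apply: le_trans E5 _.
  have h1 : K * n2 (ev x) <= K * (hnm xi + de) by rewrite ler_wpM2l // ltW.
  have h2 : de * (k * n2 (ev y)) <= de * (k * Y).
    by rewrite !ler_wpM2l // ltW.
  move: deC h1 h2; rewrite /C /theta; lra.
have yK' : n2 (ev y) <= K'.
  by rewrite -(@ler_pXn2r _ 2) // ?nnegrE ?n2_ge0 // (le_trans key).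
have := EyB B; set t := tau _; set s := tau _ => ts.
rewrite -(subrK s t); apply: le_trans (abscD _ _) _; rewrite addrC lerD //.
  by apply: le_trans (absc_tauM L _ _) _; rewrite ler_wpM2r ?n2_ge0.
apply: le_trans ts _; apply: le_trans deE; rewrite ler_wpM2l ?(ltW de0) //.
by rewrite lerDl.
Qed.

(* A bound for powers whose growth in m is only linear: iterating dbound_step
   takes 2^i-th roots of it. *)
Lemma dbound_apriori S : opb (ev S) 1 ->
  exists2 C : R, 0 <= C & forall m, dbound (S ^+ m) (theta + m%:R * C).
Proof.
move=> S1; have [C C0 dC] := dRt_bound L X j S.
have dS m : n2 (ev (dRt 1 (S ^+ m))) <= m%:R * C.
  elim: m => [|m IH].
    by rewrite expr0 -(fa_mon_nil F) /dRt dR_mon linear0 n20 mul0r.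
  rewrite exprS dRtM linearD /= evM mulr1 -natr1 mulrDl mul1r [leRHS]addrC.
  apply: le_trans (n2D _ _ _) _; apply: lerD; last first.
    by rewrite (le_trans (opbW _ S1)) // mul1r.
  apply: le_trans (dC _) _; rewrite -[leRHS]mulr1 ler_wpM2l //.
  by rewrite evX -(expr1n _ m); exact/opb_n2/opbX.
exists C => // m B; rewrite tau_dLt1M; apply: le_trans (abscB _ _) _.
rewrite mulrDl lerD //.
  apply: le_trans (psi_le _) _; rewrite ler_pM ?hnm_ge0 ?n2_ge0 ?lerDl //.
  rewrite evX -[leRHS]mul1r -(expr1n _ m); exact/opb_mulr/opbX.
apply: le_trans (absc_tauM L _ _) _.
by rewrite mulrC ler_wpM2r ?n2_ge0.
Qed.

(** [dbound_step] passes from S^2 to S while replacing K by the square root of K theta, and so maps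
    each bound theta 2^(2^i) exactly to the preceding one. *)
Lemma dbound_iterate S i : star' S = S ->
  dbound (S ^+ (2 ^ i)) (theta * 2 ^+ (2 ^ i)) -> dbound S (theta * 2).
Proof.
move=> sS; have t0 : 0 < theta := lt_le_trans ltr01 theta_ge1.
elim: i => [|i IH]; first by rewrite !expr1.
move=> b; apply: IH; apply: (@dbound_step _ (theta * 2 ^+ (2 ^ i.+1))).
- by rewrite mulr_gt0 ?exprn_gt0.
- by rewrite mulr_ge0 ?exprn_ge0 // ltW.
- by rewrite [leLHS](_ : _ = (theta * 2 ^+ (2 ^ i)) ^+ 2) // expnSr exprM; ring.
by rewrite fa_starX sS -exprD addnn -mul2n -expnS.
Qed.

Lemma dbound_contraction P : opb (ev P) 1 -> dbound P (theta * 2).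
Proof.
move=> P1; have t1 := theta_ge1.
have t0 : 0 < theta := lt_le_trans ltr01 t1.
set S := star' P * P.
have S1 : opb (ev S) 1.
  by rewrite evM ev_star // -[1]mulr1; apply: opbM => //; exact: opb_star.
have sS : star' S = S by rewrite fa_starM fa_starK.
apply: (@dbound_step P (theta * 2)); rewrite ?mulr_gt0 ?(ltW (mulr_gt0 _ _)) //.
  by nra.
have [C C0 apr] := dbound_apriori S1.
(* For m = 2^(N+1) both C + 1 <= m and m^2 <= 2^m hold, hence theta + m C <= theta m (C + 1) <=
   theta 2^m. *)
pose N := Num.truncn (C + 1).
have CN : C + 1 <= N.+1%:R by rewrite ltW // truncnS_gt.
apply: (dbound_iterate (i := N.+1)) => // B.
apply: le_trans (apr _ _) _; rewrite ler_wpM2r ?n2_ge0 //.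
set m := (2 ^ N.+1)%N.
have Nm : (N.+1 <= m)%N by rewrite ltnW // ltn_expl.
have mm : (m * m <= 2 ^ m)%N.
  rewrite -expnD leq_exp2l // addnn -mul2n /m expnS leq_mul2l /=.
  by rewrite ltn_expl.
have m1 : (1 <= m)%N by rewrite expn_gt0.
have : (m * m)%:R <= (2 : R) ^+ m by rewrite -natrX ler_nat.
have : (N.+1)%:R <= m%:R :> R by rewrite ler_nat.
have : 1 <= m%:R :> R by rewrite ler1n.
rewrite natrM; move: (m%:R : R) ((2 : R) ^+ m) CN => r q CN r1 Nr rq.
have r0 : 0 <= r by rewrite (le_trans _ r1).
have h1 : theta * (r * (C + 1)) <= theta * q.
  rewrite ler_wpM2l ?(ltW t0) // (le_trans _ rq) // ler_wpM2l //.
  exact: le_trans CN Nr.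
have h2 : 0 <= (theta - 1) * (r * C) by rewrite !mulr_ge0 // subr_ge0.
have h3 : 0 <= theta * (r - 1) by rewrite mulr_ge0 ?(ltW t0) // subr_ge0.
lra.
Qed.

(** Take B = d^* in [tau_dLt1M], with d the slice of P: [psi_le] contributes theta ||d||_2 and
    [dbound_contraction] 2 theta ||d||_2 to the bound of ||d||_2^2. *)
Lemma n2_dRt1_contraction P : opb (ev P) 1 -> n2 (ev (dRt 1 P)) <= 3 * theta.
Proof.
move=> P1; set d := dRt 1 P.
have [->|d0] := eqVneq (n2 (ev d)) 0.
  by rewrite mulr_ge0 // (le_trans _ theta_ge1).
have {}d0 : 0 < n2 (ev d) by rewrite lt_def d0 n2_ge0.
rewrite -(ler_pM2r d0) -expr2.
have := tau_dLt1M (star' d) P; rewrite -/d => E.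
have {}E : tau (ev (star' d) * ev d) =
    psi (ev (star' d) * ev P) - tau (ev (dLt 1 (star' d)) * ev P).
  by rewrite E opprB addrC subrK.
rewrite ev_star // (tau_star_mul L) -ev_star // in E.
rewrite -[leLHS]ger0_norm ?sqr_ge0 // -absc_real E.
apply: le_trans (abscB _ _) _.
have h1 := dbound_contraction P1 (star' d).
have h2 := psi_le (ev (star' d) * ev P).
have h3 : n2 (ev (star' d) * ev P) <= n2 (ev d).
  rewrite -(n2_star L (ev d)) -ev_star // -[leRHS]mul1r; exact: opb_mulr.
have h4 : hnm xi * n2 (ev (star' d) * ev P) <= theta * n2 (ev d).
  by rewrite ler_pM ?hnm_ge0 ?n2_ge0 // lerDl.
rewrite [n2 (ev (star' d))](_ : _ = n2 (ev d)) in h1; last by rewrite ev_star // n2_star.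
lra.
Qed.

Lemma n2_dRt1 P K : 0 < K -> opb (ev P) K ->
  n2 (ev (dRt 1 P)) <= 3 * theta * K.
Proof.
move=> K0 PK; have Ki : absc (K^-1)%:C = K^-1.
  by rewrite absc_real gtr0_norm // invr_gt0.
have := @n2_dRt1_contraction ((K^-1)%:C *: P).
rewrite !linearZ /= n2Z Ki mulrC ler_pdivrMr //; apply.
by have := opbZ (K^-1)%:C PK; rewrite Ki mulVf // gt_eqF.
Qed.

Lemma n2_dLt1 P K : 0 < K -> opb (ev P) K ->
  n2 (ev (dLt 1 P)) <= 3 * theta * K.
Proof.
move=> K0 PK; rewrite (dLt1_star L) // ev_star // n2_star.
by apply: n2_dRt1 => //; rewrite ev_star //; exact: opb_star.
Qed.

(** Leibniz rule for d_j (V P U) under tau (x) tau. The whole term costs theta, the terms with d_j V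
    and d_j U cost 3 theta each; the first two share ||P U||_2, whence 4 = 1 + 3. *)
Lemma tau_dRt_le U V P KU KV : 0 < KU -> 0 < KV ->
  opb (ev U) KU -> opb (ev V) KV ->
  absc (tau (ev V * ev (dRt (ev U) P))) <=
  4 * theta * KV * n2 (ev P * ev U) + 3 * theta * KU * n2 (ev V * ev P).
Proof.
move=> KU0 KV0 UK VK.
have E : tau (ev V * ev (dRt (ev U) P)) = psi (ev V * (ev P * ev U)) -
    tau (ev (dLt 1 V) * (ev P * ev U)) - tau (ev V * ev P * ev (dRt 1 U)).
  have := xi_conj (V * (P * U)); rewrite !evM => <-.
  rewrite !dRtM mulrDr !linearD /= !evM !tauD !mulr1.
  rewrite -[ev (dRt _ V)]mul1r (tau_dRt_dLt X j 1 _ V) -[ev V * ev P * _]mulrA.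
  ring.
rewrite E; apply: le_trans (abscB _ _) _; apply: lerD; last first.
  apply: le_trans (absc_tauM L _ _) _; rewrite mulrC ler_wpM2r ?n2_ge0 //.
  exact: n2_dRt1.
apply: le_trans (abscB _ _) _.
have -> : 4 * theta * KV * n2 (ev P * ev U) =
    theta * (KV * n2 (ev P * ev U)) + 3 * theta * KV * n2 (ev P * ev U) by ring.
apply: lerD.
  apply: le_trans (psi_le _) _; rewrite ler_pM ?hnm_ge0 ?n2_ge0 ?lerDl //.
  exact: opbW.
apply: le_trans (absc_tauM L _ _) _; rewrite ler_wpM2r ?n2_ge0 //.
exact: n2_dLt1.
Qed.

End ConjugateVariable.

(** * Absence of zero divisors, by induction on the degree *)

Section NoZeroDivisor.
Variables (R : realType) (M : tracialWstar R) (L : L2space M) (n : nat).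
Variables (F : freeStarAlg R n) (X : 'I_n -> M) (xi : 'I_n -> L).
Hypothesis X_sa : forall i, selfadjoint (X i).
Implicit Types (P Q : F) (u : nat -> F).
Local Notation n2 := (n2 L).
Local Notation opb := (opb L).
Local Notation ev := (ev X).
Local Notation star' := (@fa_star R n F).

Hypothesis xi_conj :
  forall j P, tau (ev (dRt X j 1 P)) = L2_tau (xi j) (ev P).
Hypothesis xi_gen : forall j (e : R), 0 < e ->
  exists P : F, hnm (xi j - L2_inj L (ev P)) <= e.

(* The projections onto ker p and ker p^* have the same trace. *)
Lemma defect_vanish (p : M) (x : nat -> M) K : opb p 1 ->
  (forall k, opb (x k) K) ->
  n2 (defect p ^+ k) @[k --> \oo] --> (0 : R) ->
  n2 (p * x k) @[k --> \oo] --> (0 : R) ->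
  n2 (x k) @[k --> \oo] --> (0 : R).
Proof.
move=> p1 xK p0 px0; have K0 : 0 <= K by case: (xK 0).
apply/cvgrPdist_le => e e0.
(* Split x_k as (x_k - b^m x_k) + b^m x_k with b = 1 - p^* p. First m makes the second part small
   uniformly in k, then k makes the first part small. *)
have K1 : 0 < K + 1 by rewrite ltr_wpDl.
have eK : 0 < e / 2 / (K + 1) by rewrite !divr_gt0.
have [m _ /(_ m (leqnn m))] := (cvgrPdist_le _ _).1 p0 _ eK.
rewrite sub0r normrN ger0_norm ?n2_ge0 // ler_pdivlMr // => me.
have em : 0 < e / 2 / m.+1%:R by rewrite !divr_gt0.
move/cvgrPdist_le: px0 => /(_ _ em); apply: filterS => k.
rewrite !sub0r !normrN !ger0_norm ?n2_ge0 // ler_pdivlMr // => ke.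
rewrite -[x k](subrK (defect (star p) ^+ m * x k)) (le_trans (n2D _ _ _)) //.
rewrite [leRHS]splitr lerD //.
  rewrite (le_trans (defect_telescope _ _ p1)) // (le_trans _ ke) //.
  by rewrite mulrC ler_wpM2l ?n2_ge0 // ler_nat.
rewrite (le_trans (opb_mulr _ (xK k))) // defect_n2_swap // (le_trans _ me) //.
by rewrite mulrC ler_wpM2l ?n2_ge0 // lerDl.
Qed.

Section Contraction.
Variables (P : F) (u : nat -> F) (K : R).
Hypotheses (P1 : opb (ev P) 1) (uK : forall k, opb (ev (u k)) K).
Hypothesis Pu : n2 (ev P * ev (u k)) @[k --> \oo] --> (0 : R).
Local Notation p := (ev P).
Local Notation v k := (defect p ^+ (k + k)).

(** The projection onto the kernel of p^*, as a vector of L^2; [kerfun] is the functional tau(kerlim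
    .) on words. *)
Definition kerlim : L := lim (L2_inj L (v k) @[k --> \oo]).
Definition kerfun (w : seq 'I_n) : R[i] :=
  hdot kerlim (L2_inj L (star (wev X w))).

Lemma kerlim_cvg : hnm (kerlim - L2_inj L (v k)) @[k --> \oo] --> (0 : R).
Proof. by apply: cvg_hnm; exact: defect_L2_cvg. Qed.

Lemma kerfun_approx k w : absc (kerfun w - tau (v k * wev X w)) <=
  hnm (kerlim - L2_inj L (v k)) * n2 (wev X w).
Proof.
rewrite -{1}[wev X w]starK -(L2_dot L) -linearBl -(n2_star L (wev X w)).
exact: cauchy_schwarz.
Qed.

(** The value at the empty word is the trace of the kernel projection, which is the limit of the
    squared norms required by [defect_vanish]. *)
Lemma kerfun_nil_eq0 : kerfun [::] = 0 -> n2 (ev (u k)) @[k --> \oo] --> (0 : R).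
Proof.
move=> k0; apply: (defect_vanish P1 uK _ Pu).
apply: cvg_sqr0 => [k|]; first exact: n2_ge0.
apply: (@squeeze_cvgr _ _ _ _ (fun=> 0)) (cvg_cst _) kerlim_cvg.
near=> k; rewrite sqr_ge0 /=; have := kerfun_approx k [::].
rewrite k0 wev_nil n21 !mulr1 sub0r abscN (defect_tau1 L) absc_real.
by rewrite ger0_norm ?sqr_ge0.
Unshelve. all: by end_near. Qed.

(* The polynomial (tau(v .) (x) id) d_j P, with v the projection onto the kernel
   of P^*, is of lower degree and still annihilates the limit of u. *)
Lemma dL_kerfun_cvg0 j :
  n2 (ev (dL j kerfun P) * ev (u k)) @[k --> \oo] --> (0 : R).
Proof.
set Q := dL j kerfun P.
have K0 : 0 <= K by case: (uK 0).
have [KQ KQ0 QK] := opb_exists L (ev Q).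
have [C C0 dC] := dL_bound L X j P.
(* With this [c], tau(Q U_k) is the squared norm of Q u_k. *)
pose c k := star' (Q * u k); pose U k := u k * c k.
have cK k : opb (ev (c k)) (KQ * K).
  by rewrite ev_star // evM; apply/opb_star/opbM.
pose KU := K * (KQ * K) + 1.
have KU0 : 0 < KU by rewrite ltr_wpDl // !mulr_ge0 // ltW.
have UK k : opb (ev (U k)) KU.
  by rewrite evM; apply: opb_le (opbM (uK k) (cK k)); rewrite lerDl.
pose V k : F := (1 - P * star' P) ^+ (k + k).
have evV k : ev (V k) = v k by rewrite evX linearB /= ev1 evM ev_star.
pose th := hnm (xi j) + 1.
have th0 : 0 <= th by rewrite addr_ge0 ?hnm_ge0.
(* The first term is the cost of replacing [kerlim] by [v k]; the other two come from
   [tau_dRt_le]. *)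
pose B k := C * KU * hnm (kerlim - L2_inj L (v k)) +
  (4 * th * (KQ * K) * n2 (p * ev (u k)) +
   3 * th * KU * n2 (star p * defect p ^+ k)).
apply: cvg_sqr0 => [k|]; first exact: n2_ge0.
apply: (@squeeze_cvgr _ _ _ _ (fun=> 0) B) (cvg_cst _) _; last first.
  have -> : 0 = C * KU * 0 + (4 * th * (KQ * K) * 0 + 3 * th * KU * 0) :> R by ring.
  apply: cvgD; first by apply: cvgMl_tmp; exact: kerlim_cvg.
  apply: cvgD; apply: cvgMl_tmp; first exact: Pu.
  apply: cvg_sqr0 => [k|]; first exact: n2_ge0.
  exact: defect_n2_star_cvg0.
near=> k; rewrite sqr_ge0 /=.
have -> : n2 (ev Q * ev (u k)) ^+ 2 = absc (tau (ev Q * ev (U k))).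
  rewrite -[LHS]ger0_norm ?sqr_ge0 // -absc_real -(tau_mul_star L).
  by rewrite !evM ev_star // evM mulrA.
have -> : ev Q = ev (dL j (fun w => kerfun w - tau (v k * wev X w)) P) +
    ev (dLt X j (v k) P).
  rewrite -linearD /=; congr (ev _); rewrite -[dL j _ P]scale1r -dL_linear_phi.
  by congr (dL j _ P); apply/funext => w; rewrite mul1r subrK.
rewrite mulrDl tauD (le_trans (abscD _ _)) // lerD //.
  apply: le_trans (absc_tauM L _ _) _; rewrite mulrAC.
  rewrite ler_pM ?n2_ge0 //; last exact: opb_n2.
  by apply: dC => [|w]; [exact: hnm_ge0|exact: kerfun_approx].
rewrite -tau_dRt_dLt -evV.
have V1 : opb (ev (V k)) 1 by rewrite evV; exact: defectX_opb.
apply: le_trans (tau_dRt_le X_sa (xi_conj j) (@xi_gen j) P KU0 ltr01 (UK k) V1) _.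
rewrite -/th mulr1 lerD // -!mulrA !ler_wpM2l // ?(ltW KU0) //.
  by rewrite evM mulrA [leRHS]mulrA; exact: opb_mulr.
rewrite evV -n2_star starM defectX_sa exprD mulrA -[leRHS]mul1r.
exact/opb_mulr/defectX_opb.
Unshelve. all: by end_near. Qed.

End Contraction.

Theorem no_zero_divisor d P u K :
  (forall v, (d < size v)%N -> fa_coef v P = 0) ->
  (exists w, fa_coef w P != 0) ->
  (forall k, opb (ev (u k)) K) ->
  n2 (ev P * ev (u k)) @[k --> \oo] --> (0 : R) ->
  n2 (ev (u k)) @[k --> \oo] --> (0 : R).
Proof.
elim: d P => [|d IH] P Pd [w Pw] uK Pu.
  have c0 : fa_coef [::] P != 0.
    by case: w Pw => // i w; rewrite Pd // eqxx.
  have Pc := fa_const Pd; set c := fa_coef [::] P in c0 Pc.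
  have ac : absc c != 0 by rewrite absc_eq0.
  have E k : n2 (ev (u k)) = (absc c)^-1 * n2 (ev P * ev (u k)).
    by rewrite Pc linearZ /= ev1 mulr_algl n2Z mulKf.
  rewrite (_ : (fun k => _) = fun k => (absc c)^-1 * n2 (ev P * ev (u k))); last first.
    by apply/funext.
  by rewrite -(mulr0 (absc c)^-1); exact: cvgMl_tmp.
have [top|] := pselect (forall v, size v = d.+1 -> fa_coef v P = 0).
  apply: (IH P) => //; last by exists w.
  by move=> v; rewrite leq_eqVlt => /orP[/eqP/esym/top|/Pd].
move=> /existsNP[v /not_implyP[vd /eqP Pv]] {w Pw}.
case: v vd Pv => [//|j v] [vd] Pv.
have [k k0 Pk] := opb_exists L (ev P).
(* Rescaling to a contraction, as the powers of the defect require. *)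
pose S := (k^-1)%:C *: P.
have ki : absc (k^-1)%:C = k^-1 by rewrite absc_real gtr0_norm // invr_gt0.
have evS : ev S = (k^-1)%:C *: ev P by rewrite linearZ.
have S1 : opb (ev S) 1.
  by rewrite evS; have := opbZ (k^-1)%:C Pk; rewrite ki mulVf // gt_eqF.
have Su : n2 (ev S * ev (u m)) @[m --> \oo] --> (0 : R).
  rewrite (_ : (fun m => _) = fun m => k^-1 * n2 (ev P * ev (u m))); last first.
    by apply/funext => m; rewrite evS -scalerAl n2Z ki.
  by rewrite -(mulr0 k^-1); exact: cvgMl_tmp.
have Sd v' : (d.+1 < size v')%N -> fa_coef v' S = 0.
  by move=> dv; rewrite fa_coefZ Pd // mulr0.
have Sv : fa_coef (j :: v) S != 0.
  rewrite fa_coefZ mulf_neq0 // -absc_eq0 ki gt_eqF ?invr_gt0 //.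
(* If the kernel projection has trace zero, u vanishes already. Otherwise the slice at the first
   letter j of a longest word keeps a nonzero coefficient at v. *)
have [k0'|kn0] := eqVneq (kerfun S [::]) 0; first exact: kerfun_nil_eq0 S1 uK Su k0'.
apply: (IH (dL j (kerfun S) S)) => //; last exact: dL_kerfun_cvg0 S1 uK Su j.
- move=> v' dv; rewrite coef_dL => [|w dw]; first by rewrite Sd // mulr0.
  by rewrite Sd // (leq_trans _ dw) // ltnW.
- exists v; rewrite coef_dL ?mulf_neq0 // => w; rewrite vd; exact: Sd.
Qed.

End NoZeroDivisor.

(** * From conjugate systems to slices *)

Lemma tau_sliceR (R : realType) (M : tracialWstar R) n (F : freeStarAlg R n)
    (X : 'I_n -> M) j (phi : seq 'I_n -> R[i]) w (b : M) :
  tau (b * ev X (sliceR F j phi w)) =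
  \sum_(k <- iota 0 (size w) | onth w k == Some j)
    tau (b * wev X (take k w)) * phi (drop k.+1 w).
Proof.
elim: w b => [|i w IH] b /=; first by rewrite big_nil linear0 mulr0 tau0.
rewrite linearD linearZ /= evM !ev_mon wev_cons wev_nil mulr1.
rewrite mulrDr tauD mulrA IH big_cons -[1%N]addn0 iotaDl big_map drop0 /=.
have -> : (Some i == Some j) = (i == j) by [].
rewrite -scalerAr tauZ.
set S1 := \sum_(_ <- _ | _) _; set S2 := \sum_(_ <- _ | _) _.
have -> : S1 = S2.
  by apply: eq_bigr => k _; rewrite add1n /= wev_cons mulrA.
by case: (i == j); rewrite ?mul1r ?mul0r ?add0r // wev_nil mulrC.
Qed.

(** A linear functional is determined on words, where [tau_sliceR] gives the sum over
    factorizations. It is applied to T = (tau (x) tau) d_j. *)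
Lemma tau_dRt1_unique (R : realType) (M : tracialWstar R) n
    (F : freeStarAlg R n) (X : 'I_n -> M) j (T : F -> R[i]) :
  (forall c P Q, T (c *: P + Q) = c * T P + T Q) ->
  (forall w, T (fa_mon F w) = \sum_(k <- iota 0 (size w) | onth w k == Some j)
    tau (wev X (take k w)) * tau (wev X (drop k.+1 w))) ->
  forall P, T P = tau (ev X (dRt X j 1 P)).
Proof.
move=> TL Tm.
have T0 : T 0 = 0 by have := TL (-1) 0 0; rewrite scaler0 addr0 mulN1r addNr.
elim/fa_ind => [|P Q eP eQ|c w]; first by rewrite !linear0 tau0.
  by rewrite -[P]scale1r TL mul1r eP eQ scale1r !linearD tauD.
rewrite -[c *: _]addr0 TL T0 !addr0 !linearZ /= tauZ; congr (_ * _).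
rewrite Tm /dRt dR_mon -[ev X _]mul1r tau_sliceR.
by apply: eq_bigr => k _; rewrite mul1r mulr1.
Qed.

Section ConjugateSystem.
Variables (R : realType) (M : tracialWstar R) (L : L2space M) (n : nat).
Variable X : 'I_n -> M.
Local Notation F := (ncpoly_free R n).

Lemma nceval_ev (P : F) : nceval X P = ev X P.
Proof.
rewrite /nceval mmapE /ev /ext /= ncsuppE; apply: eq_bigr => w _.
exact: mulr_algl.
Qed.

Lemma tau2_eval_linear (c : R[i]) (A B : nctens R n) :
  tau2_eval X (c *: A + B) = c * tau2_eval X A + tau2_eval X B.
Proof.
rewrite /tau2_eval mmapD; congr (_ + _).
rewrite (mmapEw (msuppZ_le _ _)) mmapE mulr_sumr.
by apply: eq_bigr => k _; rewrite mcoeffZ /= !mulrA.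
Qed.

Lemma tau2_eval_ncdiff j (P : F) :
  tau2_eval X (ncdiff j P) = tau (ev X (dRt X j 1 P)).
Proof.
apply: (@tau_dRt1_unique R M n F X j (fun P => tau2_eval X (ncdiff j P))).
  by move=> c A B; rewrite ncdiff_linear tau2_eval_linear.
move=> w; rewrite ncdiffU scale1r /ncdiff_word /tau2_eval raddf_sum /=.
by apply: eq_bigr => k _; rewrite mmapU /= mul1r.
Qed.

Lemma L2_gen_approx (x : L) : L2_gen X x ->
  forall e : R, 0 < e -> exists P : F, hnm (x - L2_inj L (ev X P)) <= e.
Proof.
move=> xX e e0; have e0' : 0 < e%:C by rewrite ltcR.
have [_ [[P _ <-]]] := xX _ (nbhsx_ballx _ _ e0').
rewrite -ball_normE /= nceval_ev norm_hnm ltcR => /ltW lt.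
by exists P.
Qed.

End ConjugateSystem.

(** * Atoms of the distribution and traces of polynomials *)

Section Distribution.
Variables (R : realType) (M : tracialWstar R) (Y : M).
Variable mu : probability (measurableTypeR R) R.
Hypothesis Ymu : is_distribution Y mu.

Definition hornerY (p : {poly R}) : M := horner_alg Y (map_poly (real_complex R) p).

Lemma tau_hornerY (p : {poly R}) :
  mu.-integrable setT (fun t : measurableTypeR R => (p.[t])%:E) /\
  tau (hornerY p) =
    (Rintegral mu setT (fun t : measurableTypeR R => p.[t]))%:C.
Proof.
rewrite -[p]coefK poly_def.
elim/big_ind: _ => [|q r [qi qE] [ri rE]|i _].
- split; last first.
    rewrite /hornerY !rmorph0 tau0 /Rintegral integral0_eq //.
    by move=> x _; rewrite horner0.
  rewrite (_ : (fun _ => _) = cst 0%E); first exact: integrable0.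
  by apply/funext => x; rewrite horner0.
- rewrite (_ : (fun t => (_.[t])%:E) = (EFin \o horner q) \+ (EFin \o horner r))%E;
    last by apply/funext => x; rewrite hornerD.
  split; first exact: integrableD.
  rewrite /hornerY !rmorphD tauD qE rE -rmorphD -RintegralD //.
  by congr (_%:C); apply: eq_Rintegral => x _; rewrite hornerD.
have [Xi Xt] := Ymu i.
rewrite (_ : (fun t => (_.[t])%:E) = fun t => ((p`_i)%:E * (t ^+ i)%:E)%E); last first.
  by apply/funext => x; rewrite hornerZ hornerXn.
split; first exact: integrableZl.
rewrite /hornerY -mul_polyC !rmorphM /= map_polyC map_polyXn horner_algC.
rewrite rmorphXn /= horner_algX mulr_algl tauZ Xt -rmorphM -RintegralZl //.
congr (_%:C); apply: eq_Rintegral => x _.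
by rewrite hornerM hornerC hornerXn.
Qed.

(** Such a p dominates the indicator of t; integrate against mu. *)
Lemma atom_le_tau (p : {poly R}) t : (forall x, 0 <= p.[x]) -> p.[t] = 1 ->
  fine (mu [set t]) <= complex.Re (tau (hornerY p)).
Proof.
move=> p0 pt; have [pi ->] := tau_hornerY p.
have mt : measurable [set t : measurableTypeR R] by exact: measurable_set1.
have -> : fine (mu [set t]) =
    Rintegral mu setT (\1_[set t] : measurableTypeR R -> R).
  by rewrite /Rintegral integral_indic // setIT.
apply: le_Rintegral => //; first exact: integrable_indic.
move=> x _; case: (boolP (x \in _)) => [/set_mem->|_]; last exact: p0.
by rewrite pt.
Qed.

End Distribution.

(** * Absence of atoms *)

Theorem corollary3p2 (R : realType) (M : tracialWstar R) (L : L2space M)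
    (n : nat) (X : 'I_n -> M)
    (hX : forall i, selfadjoint (X i))
    (hPhi : (free_Fisher L X < +oo)%E)
    (P : ncpoly R n)
    (hPnonconst : forall c : R[i], P <> ncconst n c)
    (hPsa : ncstar P = P)
    (mu : probability (measurableTypeR R) R)
    (hmu : is_distribution (nceval X P) mu) :
  forall t : R, mu [set t] = 0%E.
Proof.
move=> t; have [xi [xi_gen xi_conj]] : exists xi, @conjugate_system R M L n X xi.
  by move: hPhi; rewrite /free_Fisher; case: pselect.
pose F := ncpoly_free R n; pose Y := nceval X P.
have YE : ev X (P : F) = Y by rewrite -nceval_ev.
pose P0 : F := (P : F) - t%:C *: 1.
have [k k0 Pk] := opb_exists L (ev X P0).
have ki : absc (k^-1)%:C = k^-1 by rewrite absc_real gtr0_norm // invr_gt0.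
pose Q : F := (k^-1)%:C *: P0.
have evQ : ev X Q = (k^-1)%:C *: (Y - t%:C%:A).
  by rewrite linearZ linearB linearZ /= YE ev1.
set q := ev X Q in evQ.
have q1 : opb L q 1.
  by have := opbZ (k^-1)%:C Pk; rewrite ki mulVf ?gt_eqF // /q linearZ.
have starQ : fa_star Q = Q.
  rewrite /Q fa_starZ fa_starB fa_starZ fa_star1 ![Num.conj _%:C]conjc_real.
  by congr (_ *: (_ - _)); exact: hPsa.
have starq : star q = q by rewrite -ev_star // starQ.
pose u m : F := (1 - Q * fa_star Q) ^+ m.
have evu m : ev X (u m) = defect q ^+ m by rewrite evX linearB /= ev1 evM ev_star.
have Q0 : exists w, fa_coef w Q != 0.
  apply: contrapT => /forallNP Q0; apply: (hPnonconst t%:C).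
  have {}Q0 w : fa_coef w P0 = 0.
    have /negP/negPn := Q0 w; rewrite fa_coefZ mulf_eq0 => /orP[/eqP ki0|/eqP //].
    by have := invr_gt0 k; rewrite -ki ki0 (absc_real 0) normr0 ltxx k0.
  by have /eqP := fa_coef_eq0 Q0; rewrite subr_eq0 => /eqP.
have u0 : n2 L (defect q ^+ m) @[m --> \oo] --> (0 : R).
  rewrite (_ : (fun m => _) = fun m => n2 L (ev X (u m))); last first.
    by apply/funext => m; rewrite evu.
  pose d := \max_(w <- fa_supp Q) size w.
  apply: (@no_zero_divisor _ _ _ _ F X xi hX _ _ d Q u 1) => //.
  - by move=> j B; rewrite -tau2_eval_ncdiff xi_conj nceval_ev.
  - by move=> j; apply: L2_gen_approx; exact: xi_gen.
  - move=> v dv; apply: contraTeq dv => Qv; rewrite -leqNgt.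
    by apply: leq_bigmax_seq => //; exact: coef_neq0_supp.
  - by move=> m; rewrite evu; exact: defectX_opb.
  apply: cvg_sqr0 => [m|]; first exact: n2_ge0.
  rewrite (_ : (fun m => _) = fun m => n2 L (star q * defect q ^+ m) ^+ 2).
    exact: defect_n2_star_cvg0.
  by apply/funext => m; rewrite evu starq.
have le_mu m : fine (mu [set t]) <= n2 L (defect q ^+ m) ^+ 2.
  (* The even exponent makes p nonnegative on the real line. *)
  pose p : {poly R} := (1 - (k^-1 *: ('X - t%:P)) ^+ 2) ^+ (m + m).
  have -> : n2 L (defect q ^+ m) ^+ 2 = complex.Re (tau (hornerY Y p)).
    suff -> : hornerY Y p = defect q ^+ (m + m) by rewrite (defect_tau1 L).
    rewrite /hornerY /p -mul_polyC !(rmorphXn, rmorphB, rmorph1, rmorphM) /=.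
    rewrite map_polyX !map_polyC /= horner_algX !horner_algC mulr_algl -evQ.
    by rewrite /defect starq expr2.
  apply: atom_le_tau => [|x|]; first exact: hmu.
    by rewrite /p addnn -muln2 exprM horner_exp sqr_ge0.
  by rewrite /p !hornerE subrr mulr0 expr0n subr0 expr1n.
have mu_fin : mu [set t] \is a fin_num.
  by apply: fin_num_measure; exact: measurable_set1.
apply/eqP; rewrite -(fineK mu_fin) eqe; apply/negPn/negP => mu0.
have {}mu0 : 0 < fine (mu [set t]) by rewrite lt_def mu0 fine_ge0.
(* A norm below 1 exceeds its own square, so one also below the mass contradicts [le_mu]. *)
have e0 : 0 < Num.min 1 (fine (mu [set t])) by rewrite lt_min ltr01.
have [m _ /(_ m (leqnn m))] := (cvgrPdist_lt _ _).1 u0 _ e0.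
rewrite sub0r normrN ger0_norm ?n2_ge0 // lt_min => /andP[m1 mm].
have := le_mu m; have := n2_ge0 L (defect q ^+ m); nra.
Qed.
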